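(* Let $q=p^n$, with $p$ prime and $n\in \mathbb{N}$, and let $G=L_2(q)$. Then $$\kappa(G)=p^{\frac{(q^2-1)(p-2)}{p-1}}\cdot \kappa\left(\mathbb{Z}_{\frac{q-1}{k}}\right)^{q(q+1)/2}\cdot \kappa\left(\mathbb{Z}_{\frac{q+1}{k}}\right)^{q(q-1)/2},$$ where $k=\gcd(q-1, 2)$, except exactly in the cases $(p, n)=(2, 1)$, $(3, 1)$. In particular: (1) $A_5\cong L_2(5)\cong L_2(4)$ and $\kappa(A_5)=3^{10}\cdot 5^{18}$; (2) $L_3(2)\cong L_2(7)$ and $\kappa(L_3(2))=2^{84}\cdot 3^{28}\cdot 7^{40}$; (3) $A_6\cong L_2(9)$ and $\kappa(A_6)=2^{180}\cdot 3^{40}\cdot 5^{108}$.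
   Context: For a finite group $G$, the power graph $\mathcal{P}(G)$ has vertex set $G$, with two distinct elements $x,y$ adjacent if $\langle x\rangle\subseteq\langle y\rangle$ or $\langle y\rangle\subseteq\langle x\rangle$. For a connected graph $\Gamma$, the complexity $\kappa(\Gamma)$ is the number of spanning trees of $\Gamma$, and $\kappa(G)$ denotes $\kappa(\mathcal{P}(G))$. $\mathbb{Z}_m$ denotes the cyclic group of order $m$, and $L_2(q)$ denotes the projective special linear group $\mathrm{PSL}(2,q)$.
   Formalization: The cases (p,n)=(2,1),(3,1) are only excluded from the formula; that it fails exactly there is not asserted, since it in fact also holds for them (κ(L_2(2))=3 and κ(L_2(3))=3^4). *)

(* Defs.v *)
From HB Require Import structures.
From mathcomp Require Import all_boot all_order all_algebra all_fingroup all_solvable alt.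
Set Implicit Arguments. Unset Strict Implicit. Unset Printing Implicit Defensive.
Import GRing.Theory.
Local Open Scope group_scope.

Section PowerGraph.
Variable gT : finGroupType.

Definition pg_adj (x y : gT) : bool :=
  (x != y) && ((<[x]> \subset <[y]>) || (<[y]> \subset <[x]>)).

Definition pg_edges (G : {set gT}) : {set {set gT}} :=
  [set e : {set gT} | [exists x in G, exists y in G, pg_adj x y && (e == [set x; y])]].

Definition connected_on (G : {set gT}) (E : {set {set gT}}) : bool :=
  [forall x in G, forall y in G,
     connect (fun u v : gT => [set u; v] \in E) x y].

(* E is (the edge set of) a spanning tree of P(G): a subset of the edges of
   P(G) whose spanning subgraph is connected and minimally so (removing any
   edge disconnects it), i.e. a connected acyclic spanning subgraph. *)
Definition pg_spanning_tree (G : {set gT}) (E : {set {set gT}}) : bool :=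
  [&& E \subset pg_edges G, connected_on G E &
      [forall e in E, ~~ connected_on G (E :\ e)]].

Definition kappa (G : {set gT}) : nat :=
  #|[set E : {set {set gT}} | pg_spanning_tree G E]|.

End PowerGraph.

Section Linear.
Variables (n : nat) (F : finFieldType).

Definition SL_set : {set {'GL_n.+1[F]}} :=
  [set g : {'GL_n.+1[F]} | (\det (GLval g) == 1)%R].

Lemma SL_group_set : group_set SL_set.
Proof.
apply/group_setP; split; first by rewrite inE GL_1E det1.
by move=> x y; rewrite !inE GL_ME det_mulmx => /eqP-> /eqP->; rewrite GRing.mulr1.
Qed.

Canonical SL_group := Group SL_group_set.

Definition SL := SL_group.

Definition PSL := (SL / 'Z(SL))%G.

End Linear.

(* L_m(F) for m >= 1: the projective special linear group PSL(m, F) *)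
Definition L_ (m : nat) (F : finFieldType) := PSL m.-1 F.

(* kappa of the cyclic group Z_m (m >= 1); Zp m is the whole additive group
   'Z_m when m > 1 and the trivial group when m = 1 *)
Definition kappa_Z (m : nat) : nat := kappa (Zp m).

(* Main.v *)
Require Import Defs.
From mathcomp Require Import all_boot all_order all_algebra all_fingroup all_solvable all_field alt.
From mathcomp Require Import ring zify.

(** Power graph edges stay inside cyclic subgroups, so a partition of a group into
    subgroups meeting trivially cuts its power graph at the identity into blocks,
    and the complexity is the product of the complexities of the parts.

    In SL(2,q), a matrix is non-central iff it is non-scalar, and two non-scalar
    matrices commute iff they span the same line modulo scalars.  The q^2+q+1 lines of
    matrices modulo scalars therefore give subgroups of SL(2,q) that meet pairwise in
    the centre, and their images partition L_2(q).  According to the number 1, 2 or 0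
    of eigenlines, the image is of exponent p, cyclic of order dividing (q-1)/k or
    cyclic of order dividing (q+1)/k; counting the elements of SL(2,q) shows that all
    the resulting upper bounds on the orders are attained.  A group of exponent p is
    partitioned into groups of order p, whose power graph is complete, so Cayley's
    formula applies.  Cayley's formula comes from counting rooted forests as parent
    functions: detaching one vertex w from a forest with root set R gives
    (|R|+1) N(R) = |R| n N(R + w), because all the roots carry trees of the same
    average size.

    For the exceptional isomorphisms, L_2(4), L_2(5) and L_2(9) have explicit subgroups
    of index 5, 5 and 6, so they embed with index 2 in a symmetric group, while
    L_2(7) -> L_3(2) is given by its graph, enumerated from a pair of generators. *)

Set Implicit Arguments.
Unset Strict Implicit.
Unset Printing Implicit Defensive.

Import GRing.Theory.

(** * Spanning trees and Cayley's formula *)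

Section SpanningTrees.

Variable T : finType.
Implicit Types (V : {set T}) (A E : {set {set T}}).

(** The notions behind [kappa], restated for any vertex set [V] and any edge set [A], so that
    [kappa] becomes an instance of [complexity] by conversion. *)
Definition connects V E : bool :=
  [forall x in V, forall y in V, connect (fun u v : T => [set u; v] \in E) x y].

Definition spanning_tree V A E : bool :=
  [&& E \subset A, connects V E & [forall e in E, ~~ connects V (E :\ e)]].

Definition complexity V A : nat := #|[set E | spanning_tree V A E]|.

Lemma connectsP V E :
  reflect {in V &, forall x y, connect (fun u v : T => [set u; v] \in E) x y}
          (connects V E).
Proof.
apply: (iffP forall_inP) => [H x y xV yV | H x xV]; last first.
  by apply/forall_inP => y; apply: H.
by have /forall_inP := H x xV; apply.
Qed.

Lemma edge_rel_sym E : symmetric (fun u v : T => [set u; v] \in E).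
Proof. by move=> u v; rewrite setUC. Qed.

Lemma edge_connectC E : connect_sym (fun u v : T => [set u; v] \in E).
Proof. by apply: sym_connect_sym; apply: edge_rel_sym. Qed.

Lemma connects_root V E r : r \in V ->
  {in V, forall x, connect (fun u v : T => [set u; v] \in E) x r} ->
  connects V E.
Proof.
move=> rV H; apply/connectsP => x y xV yV.
by apply: connect_trans (H x xV) _; rewrite edge_connectC; apply: H.
Qed.

End SpanningTrees.

(** An edge only has to go to a path, possibly an empty one, so that [f] may contract edges as a
    retraction does. *)
Lemma connect_homo (T T' : finType) (e : rel T) (e' : rel T') (f : T -> T') :
  (forall x y, e x y -> connect e' (f x) (f y)) ->
  forall x y, connect e x y -> connect e' (f x) (f y).
Proof.
move=> fe x y /connectP[p ep ->{y}].
elim: p x ep => [|z p IHp] x //= /andP[/fe exz /IHp].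
exact: connect_trans.
Qed.

Lemma imset_pair (T T' : finType) (f : T -> T') x y :
  f @: [set x; y] = [set f x; f y].
Proof. by rewrite imsetU !imset_set1. Qed.

(** * Transport of spanning trees along an injection of the vertices *)

Section Transport.

Variables (T T' : finType) (f : T -> T') (g : T' -> T) (V : {set T}).
Variable A : {set {set T}}.
Hypothesis fK : {in V, cancel f g}.
Hypothesis AV : {in A, forall e : {set T}, e \subset V}.

Local Notation F := (fun e : {set T} => f @: e).

Lemma imset_cancel (e : {set T}) : e \subset V -> g @: (f @: e) = e.
Proof.
move=> eV; rewrite -imset_comp -[RHS]imset_id; apply: eq_in_imset => x xe /=.
by rewrite fK // (subsetP eV).
Qed.

Lemma connects_imset (E : {set {set T}}) : E \subset A ->
  connects (f @: V) (F @: E) = connects V E.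
Proof.
move=> EA; apply/connectsP/connectsP => H x y; last first.
  case/imsetP=> {}x xV -> /imsetP[{}y yV ->].
  apply: connect_homo (H x y xV yV) => u v uvE; apply: connect1.
  by rewrite -imset_pair imset_f.
move=> xV yV; have := H _ _ (imset_f f xV) (imset_f f yV).
move/(@connect_homo _ _ _ (fun u v : T => [set u; v] \in E) g).
rewrite !fK //; apply => u v /imsetP[e eE uv]; apply: connect1.
by rewrite -imset_pair uv imset_cancel // AV // (subsetP EA).
Qed.

Lemma complexity_imset : complexity (f @: V) (F @: A) = complexity V A.
Proof.
have injF : {in A &, injective F}.
  by move=> d e dA eA de; rewrite -(imset_cancel (AV dA)) de imset_cancel ?AV.
rewrite /complexity.
have -> : [set E | spanning_tree (f @: V) (F @: A) E]
         = (fun E : {set {set T}} => F @: E) @: [set E | spanning_tree V A E].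
  have treeF (E : {set {set T}}) : E \subset A ->
      spanning_tree (f @: V) (F @: A) (F @: E) = spanning_tree V A E.
    move=> EA; rewrite /spanning_tree EA imsetS //= connects_imset //.
    (* [F] is injective on [A], so deleting an edge commutes with taking images. *)
    congr (_ && _); have FD e : e \in E -> (F @: E) :\ F e = F @: (E :\ e).
      move=> eE; apply/setP=> d; rewrite !inE; apply/andP/imsetP.
        case=> dFe /imsetP[c cE dc]; exists c => //; rewrite !inE cE andbT.
        by apply: contraNneq dFe => <-; rewrite dc.
      case=> c; rewrite !inE => /andP[ce cE] ->; rewrite imset_f //; split=> //.
      by apply: contraNneq ce => /injF->//; apply: (subsetP EA).
    apply/forall_inP/forall_inP => H e.
      move=> eE; have := H _ (imset_f F eE); rewrite FD // connects_imset //.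
      exact: subset_trans (subsetDl _ _) EA.
    case/imsetP=> c cE ->; rewrite FD // connects_imset ?H //.
    exact: subset_trans (subsetDl _ _) EA.
  apply/setP=> E'; rewrite inE; apply/idP/imsetP.
    (* A tree of the image graph is the image of its preimage inside [A]. *)
    move=> tE'; have /and3P[/subsetP E'A _ _] := tE'.
    have E'E : E' = F @: (A :&: F @^-1: E').
      apply/setP=> e; apply/idP/imsetP.
        by move=> eE; case/imsetP: (E'A _ eE) => c cA ec; exists c; rewrite ?inE ?cA -?ec.
      by case=> c; rewrite !inE => /andP[_ cE] ->.
    by exists (A :&: F @^-1: E') => //; rewrite inE -treeF ?subsetIl // -E'E.
  by case=> E; rewrite inE => tE ->; rewrite treeF //; case/and3P: tE.
apply: card_in_imset => D E; rewrite !inE => /and3P[DA _ _] /and3P[EA _ _] DE.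
have imK (B : {set {set T}}) : B \subset A -> (fun e : {set T'} => g @: e) @: (F @: B) = B.
  move=> BA; rewrite -imset_comp -[RHS]imset_id; apply: eq_in_imset => e eB /=.
  by rewrite imset_cancel // AV // (subsetP BA).
by rewrite -(imK _ DA) DE imK.
Qed.

End Transport.

(** * Counting rooted forests *)

Section Cayley.

Variable T : finType.
Implicit Types (R : {set T}) (f g : {ffun T -> T}) (x y w : T).

Local Notation n := #|T|.

(** A forest is encoded by its parent function, the roots being fixed. Since [n] steps suffice to
    reach a root, [iter n f x] is the root of the tree of [x]. *)
Definition rooted_forest R f : bool :=
  [forall x in R, f x == x] && [forall x, iter n f x \in R].

(** The first visit to a root occurs before the orbit repeats, hence within [n] steps; from there on
    the orbit is constant. *)
Lemma rooted_forestP R f :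
  reflect ({in R, forall x, f x = x} /\ forall x, exists k, iter k f x \in R)
          (rooted_forest R f).
Proof.
apply: (iffP andP) => [[/forall_inP fR /forallP Rf] | [fR Rf]]; split.
- by move=> x /fR/eqP.
- by move=> x; exists n.
- by apply/forall_inP => x /fR->.
apply/forallP=> x; have [k kR] := Rf x.
have iR j m y : iter j f y \in R -> iter (m + j) f y = iter j f y.
  by move=> jR; elim: m => //= m ->; apply: fR.

have le_n : findex f x (iter k f x) <= n.
  by apply: ltnW; apply: leq_trans (findex_max (fconnect_iter f k x)) _; apply: max_card.
by rewrite -(subnK le_n) iR // iter_findex ?fconnect_iter.
Qed.

(** With [y = w] this detaches [w] and makes it a root; with another [y] it grafts [w] below [y]. *)
Definition reroot f w y : {ffun T -> T} := [ffun x => if x == w then y else f x].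

Lemma iter_reroot f w y x k : (forall j, j < k -> iter j f x != w) ->
  iter k (reroot f w y) x = iter k f x.
Proof.
elim: k => //= k IHk Hk; rewrite IHk => [|j jk]; last by apply: Hk; apply: ltnW.
by rewrite ffunE (negPf (Hk k _)).
Qed.

Lemma iter_reroot_hit f w y x k : iter k f x = w ->
  exists2 j, j <= k & iter j (reroot f w y) x = w.
Proof.
move=> kw; have ex : exists j, iter j f x == w by exists k; rewrite kw.
case: (ex_minnP ex) => j /eqP jw jmin; exists j; first by apply: jmin; rewrite kw.
rewrite iter_reroot // => i ij; apply/negP=> /jmin; by rewrite leqNgt ij.
Qed.

(** The second conclusion says that the former parent of [w] stays in a tree rooted in [R] and does
    not fall into the tree detached with [w]. *)
Lemma cut_root R f w : w \notin R -> rooted_forest R f ->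
  rooted_forest (w |: R) (reroot f w w) /\ iter n (reroot f w w) (f w) \in R.
Proof.
move=> wR ff; have /rooted_forestP[fR Rf] := ff.
set g := reroot f w w.
have fg : rooted_forest (w |: R) g.
  apply/rooted_forestP; split=> [x|x].
    by rewrite !inE ffunE; case: eqP => [-> //|_ /= /fR].
  case: (boolP [exists k : 'I_n.+1, iter k f x == w]) => [/existsP[k /eqP kw]|].
    have [j _ jw] := iter_reroot_hit w kw; exists j; by rewrite jw !inE eqxx.
  move=> noW; exists n; rewrite iter_reroot; last first.
    by move=> j jn; apply: contra noW => jw; apply/existsP; exists (Ordinal (leqW jn)).
  by rewrite !inE (forallP (proj2 (andP ff))) orbT.
split=> //.
(* the forward orbit of [f w] avoids [w], otherwise [w] would lie on a cycle *)
have noW k : iter k f (f w) != w.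
  apply/eqP=> kw; have per m : iter (m * k.+1) f w = w.
    by elim: m => // m IHm; rewrite mulSn addnC iterD iterSr kw.
  have [j jR] := Rf w; have jj m : iter (m + j) f w = iter j f w.
    by elim: m => //= m ->; apply: fR.
  have := jj (j * k); rewrite addnC -mulnS per => wj; by rewrite wj jR in wR.
rewrite iter_reroot //; exact: (forallP (proj2 (andP ff))).
Qed.

(** This inverts [cut_root]: as the root of [y] is in [R], the path from [y] upwards avoids [w], and
    no cycle is created. *)
Lemma graft_root R g w y : w \notin R -> rooted_forest (w |: R) g ->
  iter n g y \in R -> rooted_forest R (reroot g w y).
Proof.
move=> wR gg yR; have /rooted_forestP[gR _] := gg.
have R_w x : x \in R -> x != w by move=> xR; apply: contraNneq wR => <-.
have to_R x k : iter k g x \in R -> iter k (reroot g w y) x = iter k g x.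
  move=> kR; apply: iter_reroot => j jk; apply/eqP=> jw.
  have wk m : iter (m + j) g x = w.
    by elim: m => //= m ->; apply: gR; rewrite !inE eqxx.
  by rewrite -(subnK (ltnW jk)) wk (negPf wR) in kR.
apply/rooted_forestP; split=> [x xR | x].
  by rewrite ffunE (negPf (R_w x xR)) gR // !inE xR orbT.
have := forallP (proj2 (andP gg)) x; rewrite !inE => /orP[/eqP nw | nR]; last first.
  by exists n; rewrite to_R.
have [j _ jw] := iter_reroot_hit y nw.
by exists (n.+1 + j); rewrite iterD jw iterSr ffunE eqxx to_R.
Qed.

Definition forests R := [set f | rooted_forest R f].

(** Cutting above [w] while remembering the parent [f w] is a bijection onto the pairs in [D], with
    grafting as inverse. *)
Lemma card_forests_cut R w : w \notin R ->
  #|forests R| = \sum_(g in forests (w |: R)) #|[set y | iter n g y \in R]|.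
Proof.
move=> wR.
pose D := [set u : {ffun T -> T} * T | (u.1 \in forests (w |: R)) && (iter n u.1 u.2 \in R)].
transitivity #|D|.
  rewrite -(card_in_imset (f := fun f : {ffun T -> T} => (reroot f w w, f w))
             (D := mem (forests R))).
    apply: eq_card => -[g y]; rewrite inE /=; apply/imsetP/andP.
      case=> f; rewrite inE => ff [-> ->].
      by have [h1 h2] := cut_root wR ff; rewrite inE.
    rewrite inE => -[gg yR]; exists (reroot g w y); first by rewrite inE graft_root.
    congr pair; last by rewrite ffunE eqxx.
    have /rooted_forestP[gR _] := gg.
    apply/ffunP=> x; rewrite !ffunE; case: eqP => // ->.
    by rewrite gR // !inE eqxx.
  move=> f g _ _ [/ffunP fg fgw]; apply/ffunP=> x; have := fg x; rewrite !ffunE.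
  by case: eqP => [-> //|].
rewrite -sum1_card (eq_bigl (fun u => (u.1 \in forests (w |: R)) &&
                                   (u.2 \in [set y | iter n u.1 y \in R]))).
  rewrite -(pair_big_dep (fun g => g \in forests (w |: R))
             (fun g y => y \in [set y | iter n g y \in R]) (fun _ _ => 1)) /=.
  by apply: eq_bigr => g _; rewrite sum1_card.
by move=> [g y]; rewrite !inE.
Qed.

(** Conjugation by the transposition of [a] and [b] permutes the forests and exchanges the trees at
    these two roots. *)
Lemma sum_tree_size R a b : a \in R -> b \in R ->
  \sum_(g in forests R) #|[set y | iter n g y == a]|
    = \sum_(g in forests R) #|[set y | iter n g y == b]|.
Proof.
move=> aR bR; pose t := tperm a b.
pose h (g : {ffun T -> T}) := [ffun x => t (g (t x))].
have hK : involutive h by move=> g; apply/ffunP=> x; rewrite !ffunE !tpermK.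
have tR x : (t x \in R) = (x \in R).
  by rewrite /t; case: tpermP => [->|->|]; rewrite ?aR ?bR.
have ith k g x : iter k (h g) x = t (iter k g (t x)).
  by elim: k => /= [|k ->]; rewrite ?tpermK // ffunE tpermK.
have hF g : (h g \in forests R) = (g \in forests R).
  suff imp g' : g' \in forests R -> h g' \in forests R.
    by apply/idP/idP => /imp //; rewrite hK.
  rewrite !inE => /rooted_forestP[gR Rg]; apply/rooted_forestP; split=> [x xR|x].
    by rewrite ffunE gR ?tR // tpermK.
  by have [k kR] := Rg (t x); exists k; rewrite ith tR.
rewrite (reindex_inj (inv_inj hK)) /=; apply: eq_big => [g|g _]; first exact: hF.
rewrite -[RHS](card_imset _ (@perm_inj _ t)); apply: eq_card => y.
rewrite !inE ith -[y in RHS](tpermK a b) (mem_imset _ _ (@perm_inj _ t)) inE.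
by rewrite -(inj_eq (@perm_inj _ t)) tpermK tpermL.
Qed.

Lemma card_forests_step R w : w \notin R ->
  #|R|.+1 * #|forests R| = #|R| * n * #|forests (w |: R)|.
Proof.
move=> wR; rewrite (card_forests_cut wR).
(* In each forest every vertex lies under exactly one root. *)
have total : \sum_(a in w |: R) \sum_(g in forests (w |: R)) #|[set y | iter n g y == a]|
             = n * #|forests (w |: R)|.
  rewrite exchange_big /= mulnC -sum_nat_const; apply: eq_bigr => g gF.
  under eq_bigr => a _ do rewrite -sum1_card.
  rewrite (exchange_big_dep xpredT) //= -[RHS]sum1_card; apply: eq_bigr => y _.
  rewrite (big_pred1 (iter n g y)) // => a /=; rewrite [y \in _]inE [iter _ _ _ == _]eq_sym.
  case: eqP => [->|_]; rewrite ?andbT ?andbF //.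
  by move: gF; rewrite inE => /andP[_ /forallP->].
have each a : a \in w |: R ->
    \sum_(g in forests (w |: R)) #|[set y | iter n g y == a]|
    = \sum_(g in forests (w |: R)) #|[set y | iter n g y == w]|.
  by move=> aR; apply: sum_tree_size; rewrite // !inE eqxx.
rewrite (eq_bigr _ each) sum_nat_const cardsU1 wR add1n in total.
set s := \sum_(g in _) #|[set y | _ == w]| in total.
(* The vertices not under [w] are those under a root in [R]. *)
have split : \sum_(g in forests (w |: R)) #|[set y | iter n g y \in R]| + s
             = n * #|forests (w |: R)|.
  rewrite -big_split /= mulnC -sum_nat_const; apply: eq_bigr => g; rewrite inE => gF.
  rewrite -cardsUI addnC (_ : _ :&: _ = set0) ?cards0 ?add0n.
    rewrite -[RHS]cardsT; apply: eq_card => y; rewrite !inE orbC.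
    by have := forallP (proj2 (andP gF)) y; rewrite !inE.
  by apply/setP=> y; rewrite !inE; case: eqP => [->|]; rewrite ?andbF // (negPf wR).
apply/eqP; rewrite -(eqn_add2r (#|R|.+1 * s)) -mulnDr split total.
by rewrite mulSn addnC mulnA.
Qed.

(** Induction on the number of non-roots, turning one more vertex into a root at each step. The
    factor [n] on the left replaces an exponent [n - #|R| - 1], which would be negative when every
    vertex is a root. *)
Lemma card_forests R : 0 < #|R| -> n * #|forests R| = #|R| * n ^ (n - #|R|).
Proof.
move=> R0; have [m mE] : exists m, n - #|R| = m by exists (n - #|R|).
elim: m R R0 mE => [|m IHm] R R0 mE; rewrite mE.
  have RT : R = setT.
    by apply/eqP; rewrite eqEcard subsetT cardsT -subn_eq0 mE.
  rewrite RT cardsT expn0 muln1 (_ : forests _ = [set [ffun x => x]]) ?cards1 ?muln1 //.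
  apply/setP=> f; rewrite !inE; apply/rooted_forestP/eqP.
    by case=> fE _; apply/ffunP=> x; rewrite ffunE fE.
  by move->; split=> [x _|x]; [rewrite ffunE | exists 0; rewrite inE].
have [w wR] : exists w, w \notin R.
  apply/existsP; rewrite -negb_forall; apply/negP=> /forallP allR.
  have : R = setT by apply/setP=> x; rewrite inE allR.
  by move=> RT; rewrite RT cardsT subnn in mE.
have cw : #|w |: R| = #|R|.+1 by rewrite cardsU1 wR.
have := IHm (w |: R); rewrite cw subnS mE => /(_ isT erefl) IH.
apply/eqP; rewrite -(eqn_pmul2l (ltn0Sn #|R|)) mulnCA (card_forests_step wR).
by rewrite -!mulnA IH expnS !(mulnCA n) mulnCA.
Qed.

End Cayley.

(** * Spanning trees of a complete graph as forests with one root *)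

Section TreesAndForests.

Variables (T : finType) (r : T).
Implicit Types (f g : {ffun T -> T}) (E : {set {set T}}).

Definition forest_edges f : {set {set T}} := [set [set x; f x] | x in [set~ r]].

Lemma forest_loopless f x : rooted_forest [set r] f -> f x = x -> x = r.
Proof.
move=> /rooted_forestP[_ /(_ x)[k]] + fx.
by rewrite (_ : iter k f x = x) ?inE => [/eqP|]; last by elim: k => //= k ->.
Qed.

(** A 2-cycle is stable under iteration, so it would have to contain the root. Hence the edges above
    [x] and above [f x] never coincide, which lets the parent function be recovered from the
    edges. *)
Lemma forest_acyclic f x : rooted_forest [set r] f -> f (f x) = x -> x = r.
Proof.
move=> ff ffx; have /rooted_forestP[fr /(_ x)[k]] := ff.
have fr1 : f r = r by rewrite fr ?inE.
have : (iter k f x == x) || (iter k f x == f x).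
  elim: k => /= [|k /orP[]/eqP->]; rewrite ?eqxx ?ffx ?eqxx ?orbT //.
by case/orP=> /eqP->; rewrite inE => /eqP xr //; rewrite -ffx xr.
Qed.

Lemma forest_edge_mem f x : x != r -> [set x; f x] \in forest_edges f.
Proof. by move=> xr; apply: imset_f; rewrite !inE. Qed.

Lemma forest_connects f : rooted_forest [set r] f -> connects setT (forest_edges f).
Proof.
move=> ff; apply: (@connects_root _ _ _ r) => // x _.
have /rooted_forestP[fr /(_ x)[k]] := ff; rewrite inE.
elim: k x => [|k IHk] x; first by move=> /eqP /= ->.
rewrite iterSr => /IHk fx; case: (eqVneq x r) => [-> //|xr].
by apply: connect_trans (connect1 _) fx; apply: forest_edge_mem.
Qed.

Lemma forest_spanning_tree f : rooted_forest [set r] f ->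
  spanning_tree setT [set e : {set T} | #|e| == 2] (forest_edges f).
Proof.
move=> ff; have /rooted_forestP[fr Rf] := ff.
have fr1 : f r = r by rewrite fr ?inE.
apply/and3P; split; last 1 first.
- apply/forall_inP=> _ /imsetP[x xr ->]; rewrite !inE in xr.
  (* the descendants of [x] are closed under the remaining edges *)
  pose desc := [pred u | fconnect f u x].
  have clos : closed (fun u v : T => [set u; v] \in forest_edges f :\ [set x; f x]) desc.
    apply: intro_closed; first exact: edge_connectC.
    have step u : u != x -> (u \in desc) = (f u \in desc).
      move=> ux; rewrite !inE; apply/idP/idP; last exact: connect_trans (fconnect1 f u).
      move/iter_findex; case: (findex f u x) => [|k] /=.
        by move/eqP; rewrite (negPf ux).
      by rewrite -iterS iterSr => <-; apply: fconnect_iter.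
    move=> u v; rewrite in_setD1 => /andP[uvx /imsetP[z zr uvz]] ux.
    have zx : z != x by apply: contraNneq uvx => <-; rewrite uvz.
    have : v \in [set z; f z] by rewrite -uvz !inE eqxx orbT.
    have : u \in [set z; f z] by rewrite -uvz !inE eqxx.
    have zz := step z zx.
    by rewrite in_set2 => /orP[]/eqP uz; rewrite uz in ux;
      rewrite in_set2 => /orP[]/eqP->; rewrite -?zz // ?zz.
  apply/negP=> /connectsP/(_ x r) => /(_ (in_setT _) (in_setT _)).
  move/(closed_connect clos); rewrite !inE connect0 => /esym/iter_findex.
  have -> k : iter k f r = r by elim: k => //= k ->.
  by move=> rx; rewrite rx eqxx in xr.
- apply/subsetP=> _ /imsetP[x xr ->]; rewrite !inE in xr *.
  rewrite cards2; case: (eqVneq x (f x)) => // fx.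
  by rewrite (forest_loopless ff (esym fx)) eqxx in xr.
- exact: forest_connects.
Qed.

Lemma forest_edges_inj : {in forests [set r] &, injective forest_edges}.
Proof.
move=> f g; rewrite !inE => ff gg fg.
have /rooted_forestP[fr Rf] := ff; have /rooted_forestP[gr _] := gg.
have fg_r : f r = g r by rewrite fr ?gr ?inE.
(* a disagreement at [x] forces one at [f x], so it would propagate to the root *)
have bad x : f x != g x -> f (f x) != g (f x).
  move=> xN; have xr : x != r by apply: contraNneq xN => ->; rewrite fg_r.
  have /imsetP[w] : [set x; f x] \in forest_edges g by rewrite -fg forest_edge_mem.
  rewrite !inE => wr /setP xfw.
  (* Either [w = x], which gives [f x = g x], or [w = f x], which gives [g (f x) = x]; in the latter
     case [f (f x) = x] is excluded by acyclicity. *)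
  have := xfw w; rewrite !inE eqxx /= => /orP[]/eqP wE.
    have := xfw (g x); have := xfw (f x); rewrite wE !inE !eqxx !orbT /= => /esym/orP[]/eqP fx.
      by rewrite (forest_loopless ff fx) eqxx in xr.
    by rewrite fx eqxx in xN.
  have := xfw x; rewrite wE !inE eqxx /= => /esym/orP[]/eqP xw.
    by rewrite (forest_loopless ff (esym xw)) eqxx in xr.
  apply: contraNneq xr => ffx; apply/eqP; apply: (forest_acyclic ff).
  by rewrite ffx -xw.
apply/ffunP=> x; apply/eqP; apply/negPn/negP=> xN; have [k] := Rf x.
have : f (iter k f x) != g (iter k f x) by elim: k => //= k; apply: bad.
by move=> kN; rewrite inE => /eqP kr; rewrite kr fg_r eqxx in kN.
Qed.

(** Each vertex takes as parent a neighbour strictly closer to [r]; the distance [d] to [r] then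
    decreases along the orbits, which therefore end at [r]. *)
Lemma connects_forest E : connects setT E ->
  exists2 f, rooted_forest [set r] f & forest_edges f \subset E.
Proof.
move=> /connectsP cE; pose e := fun u v : T => [set u; v] \in E.
have ex x : exists k, [exists p : k.-tuple T, path e x p && (last x p == r)].
  have /connectP[p ep ->] := cE x r (in_setT _) (in_setT _).
  by exists (size p); apply/existsP; exists (in_tuple p); rewrite ep eqxx.
pose d x := ex_minn (ex x).
have dmin x p : path e x p -> last x p = r -> d x <= size p.
  move=> ep lp; rewrite /d; case: ex_minnP => k _; apply; apply/existsP.
  by exists (in_tuple p); rewrite ep lp eqxx.
have par x : x != r -> [exists y, e x y && (d y < d x)].
  move=> xr.
  have [[|y p]] : exists2 p, path e x p && (last x p == r) & size p = d x.
    rewrite /d; case: ex_minnP => k /existsP[p pP] _; exists p => //; exact: size_tuple.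
  by rewrite /= (negPf xr).
  move=> /= /andP[/andP[exy ep] /eqP lp] sz; apply/existsP; exists y.
  by rewrite exy -sz ltnS dmin.
pose f := [ffun x => if x == r then r else odflt x [pick y | e x y && (d y < d x)]].
have fr : f r = r by rewrite ffunE eqxx.
have fx x : x != r -> e x (f x) /\ d (f x) < d x.
  move=> xr; rewrite ffunE (negPf xr); case: pickP => [y /andP[]//|noy].
  by have /existsP[y] := par x xr; rewrite noy.
exists f; last by apply/subsetP=> _ /imsetP[x xr ->]; rewrite !inE in xr; case: (fx x xr).
apply/rooted_forestP; split=> [x|x]; first by rewrite inE => /eqP->.
elim: {x}(d x).+1 {-2}x (ltnSn (d x)) => // m IHm x dx.
case: (eqVneq x r) => [->|xr]; first by exists 0; rewrite inE.
have [_ lt] := fx x xr; have [|k kr] := IHm (f x); first exact: leq_trans lt _.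
by exists k.+1; rewrite iterSr.
Qed.

Lemma complexity_complete :
  complexity setT [set e : {set T} | #|e| == 2] = #|T| ^ (#|T| - 2).
Proof.
have <- : #|forests [set r]| = #|T| ^ (#|T| - 2).
  have T0 : 0 < #|T| by apply/card_gt0P; exists r.
  apply/eqP; rewrite -(eqn_pmul2l T0) card_forests ?cards1 // mul1n.
  by case: #|T| T0 => [|[|m]] // _; rewrite !subSS !subn0 -expnS.
rewrite -(card_in_imset forest_edges_inj); apply: eq_card => E; rewrite inE.
apply/idP/imsetP => [tE | [f]]; last by rewrite inE => /forest_spanning_tree + ->.
have /and3P[EA cE /forall_inP mE] := tE.
(* By connectedness a spanning tree contains the edges of some forest, and by minimality it has no
   others. *)
have [f ff fE] := connects_forest cE; exists f; first by rewrite inE.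
apply/eqP; rewrite eqEsubset fE andbT; apply/subsetP=> e eE; apply/negPn/negP=> ef.
case/negP: (mE e eE); have /connectsP cf := forest_connects ff.
apply/connectsP=> x y xT yT; apply: connect_sub (cf x y xT yT) => u v uv.
apply: connect1; rewrite !inE (subsetP fE) // andbT.
by apply: contraNneq ef => <-.
Qed.

End TreesAndForests.

Lemma complexity_complete_on (T : finType) (V : {set T}) : 0 < #|V| ->
  complexity V [set e : {set T} | (e \subset V) && (#|e| == 2)] = #|V| ^ (#|V| - 2).
Proof.
case/card_gt0P=> x0 x0V.
have r : 'I_#|V| by apply: (enum_rank_in x0V x0).
rewrite -[in RHS](card_ord #|V|) -(complexity_complete r).
pose f : 'I_#|V| -> T := @enum_val T (mem V); pose g : T -> 'I_#|V| := enum_rank_in x0V.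
have fK : cancel f g by move=> i; apply: enum_valK_in.
have fV : f @: setT = V.
  apply/setP=> x; apply/imsetP/idP => [[i _ ->]|xV]; first exact: enum_valP.
  by exists (g x) => //; rewrite /f enum_rankK_in.
rewrite -(@complexity_imset _ _ f g setT [set e : {set 'I_#|V|} | #|e| == 2]); first last.
- by move=> e _; apply: subsetT.
- by move=> i _; apply: fK.
rewrite fV; congr (complexity _ _); apply/setP=> e; rewrite !inE.
apply/andP/imsetP => [[eV e2]|[d]].
  exists (g @: e); last first.
    rewrite -imset_comp -[LHS]imset_id; apply: eq_in_imset => x xe /=.
    by rewrite /f enum_rankK_in // (subsetP eV).
  rewrite inE card_in_imset // => x y /(subsetP eV) xV /(subsetP eV) yV.
  exact: (enum_rank_in_inj xV yV).
rewrite inE => /eqP d2 ->; rewrite card_imset ?d2; last exact: can_inj fK.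
by split=> //; apply/subsetP=> _ /imsetP[i _ ->]; apply: enum_valP.
Qed.

Local Open Scope group_scope.

(** * Power graphs of partitioned groups *)

Lemma kappaE (gT : finGroupType) (G : {set gT}) : kappa G = complexity G (pg_edges G).
Proof. by []. Qed.

Lemma pg_edgesP (gT : finGroupType) (G : {set gT}) (e : {set gT}) :
  reflect (exists x y, [/\ x \in G, y \in G, pg_adj x y & e = [set x; y]])
          (e \in pg_edges G).
Proof.
rewrite inE; apply: (iffP exists_inP) => [[x xG /exists_inP[y yG /andP[xy /eqP->]]]|].
  by exists x, y.
case=> x [y [xG yG xy ->]]; exists x => //; apply/exists_inP; exists y => //.
by rewrite xy eqxx.
Qed.

Lemma pg_edges_sub (gT : finGroupType) (G : {set gT}) :
  {in pg_edges G, forall e : {set gT}, e \subset G}.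
Proof. by move=> _ /pg_edgesP[x [y [xG yG _ ->]]]; rewrite subUset !sub1set xG. Qed.

Lemma kappa_isog (gT rT : finGroupType) (G : {group gT}) (H : {group rT}) :
  G \isog H -> kappa G = kappa H.
Proof.
case/isogP=> f injf fG; rewrite !kappaE -fG morphimEdom.
rewrite -(@complexity_imset _ _ f (invm injf) G (pg_edges G)); first last.
- exact: pg_edges_sub.
- by move=> x xG; apply: invmE.
have adjf : {in G &, forall x y, pg_adj (f x) (f y) = pg_adj x y}.
  move=> x y xG yG; rewrite /pg_adj (inj_in_eq (injmP injf)) // -!morphim_cycle //.
  by rewrite !injmSK // ?cycle_subG.
congr (complexity _ _); apply/setP=> e; apply/imsetP/pg_edgesP.
  case=> _ /pg_edgesP[x [y [xG yG xy ->]]] ->; exists (f x), (f y).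
  by rewrite !imset_f // adjf // imset_pair.
case=> _ [_ [/imsetP[x xG ->] /imsetP[y yG ->]]]; rewrite adjf // => xy ->.
exists [set x; y]; last by rewrite imset_pair.
by apply/pg_edgesP; exists x, y.
Qed.

(** * Blocks of the power graph of a partitioned group *)

Section GroupPartition.

Variables (gT : finGroupType) (I : finType) (H : I -> {group gT}) (G : {group gT}).
Hypothesis coverG : \bigcup_i H i = G :> {set gT}.
Hypothesis tiH : forall i j, i != j -> H i :&: H j = 1.

Lemma part_sub i : H i \subset G.
Proof. by rewrite -coverG; apply: (bigcup_sup i). Qed.

Lemma pg_edge_not1 (K : {group gT}) e : e \in pg_edges K -> ~~ (e \subset [1 gT]).
Proof.
case/pg_edgesP=> x [y [_ _ /andP[xy _] ->]]; rewrite subUset !sub1set !inE.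
by apply: contra xy => /andP[/eqP-> /eqP->].
Qed.

Lemma part_edge_uniq e i j : e \in pg_edges (H i) -> e \in pg_edges (H j) -> i = j.
Proof.
move=> ei ej; apply/eqP; apply: contraNT (pg_edge_not1 ei) => ij.
by rewrite -(tiH ij) subsetI !(pg_edges_sub (G := H _)).
Qed.

(** The part containing a generator of the larger cyclic group contains the smaller cyclic group as
    well. *)
Lemma part_edges e : e \in pg_edges G -> exists i, e \in pg_edges (H i).
Proof.
case/pg_edgesP=> x [y [xG yG xy ->]].
wlog sxy : x y xG yG xy / <[x]> \subset <[y]>.
  move=> W; have /andP[_ /orP[sxy|syx]] := xy; first exact: W.
  rewrite setUC; apply: W => //; move: xy; by rewrite /pg_adj eq_sym orbC.
move: (yG); rewrite -coverG => /bigcupP[i _ yi]; exists i.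
apply/pg_edgesP; exists x, y; split=> //.
by apply: subsetP (cycle_id x); apply: subset_trans sxy _; rewrite cycle_subG.
Qed.

Lemma part_edges_sub i : pg_edges (H i) \subset pg_edges G.
Proof.
apply/subsetP=> _ /pg_edgesP[x [y [xi yi xy ->]]]; apply/pg_edgesP; exists x, y.
by rewrite !(subsetP (part_sub i)).
Qed.

(* Collapsing everything outside [H i] to the cut vertex 1 retracts the graph onto [H i]. *)
Lemma part_connects (E : {set {set gT}}) : E \subset pg_edges G ->
  connects G E = [forall i, connects (H i) (E :&: pg_edges (H i))].
Proof.
move=> EG; apply/idP/forallP => [/connectsP cE i | cE].
  apply/connectsP=> x y xi yi; pose rho z := if z \in H i then z else 1.
  have rhoE z : z \in H i -> rho z = z by rewrite /rho => ->.
  move: (subsetP (part_sub i)) => si.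
  suff hom u v : [set u; v] \in E ->
      connect (fun a b => [set a; b] \in E :&: pg_edges (H i)) (rho u) (rho v).
    by have := connect_homo hom (cE x y (si _ xi) (si _ yi)); rewrite !rhoE.
  move=> uvE.
  have [j uvj] := part_edges (subsetP EG _ uvE).
  have := pg_edges_sub uvj; rewrite subUset !sub1set => /andP[uj vj].
  case: (eqVneq i j) => [ij | ij].
    rewrite -ij in uj vj uvj; rewrite !rhoE //; apply: connect1.
    by rewrite inE uvE.
  have out z : z \in H j -> rho z = 1.
    move=> zj; rewrite /rho; case: ifP => // zi; apply/set1P.
    by rewrite -[[set 1]](tiH ij) inE zi.
  by rewrite !out.
apply: (@connects_root _ _ _ 1) => // x; rewrite -coverG => /bigcupP[i _ xi].
have /connectsP/(_ x 1 xi (group1 _)) := cE i.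
apply: connect_sub => u v; rewrite inE => /andP[uvE _]; exact: connect1.
Qed.

(** Deleting an edge changes the trace on one block only, so minimality, like connectedness, can be
    tested block by block. *)
Lemma part_spanning_tree (E : {set {set gT}}) : E \subset pg_edges G ->
  spanning_tree G (pg_edges G) E =
    [forall i, spanning_tree (H i) (pg_edges (H i)) (E :&: pg_edges (H i))].
Proof.
move=> EG; have EDG e : E :\ e \subset pg_edges G.
  exact: subset_trans (subsetDl _ _) EG.
apply/and3P/forallP => [[_ + /forall_inP mE] i | tE]; last first.
  have cE : connects G E.
    by rewrite part_connects //; apply/forallP=> i; case/and3P: (tE i).
  split=> //; apply/forall_inP=> e eE.
  have [i ei] := part_edges (subsetP EG _ eE).
  have /and3P[_ _ /forall_inP/(_ e)] := tE i; rewrite inE eE ei => /(_ isT).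
  apply: contra; rewrite part_connects // => /forallP/(_ i).
  by rewrite setIDAC.
rewrite part_connects // => /forallP cE; rewrite /spanning_tree subsetIr cE /=.
apply/forall_inP=> e; rewrite inE => /andP[eE ei]; apply: contra (mE e eE) => ci.
rewrite part_connects //; apply/forallP=> j; case: (eqVneq i j) => [<-|ij].
  by rewrite setIDAC.
rewrite (_ : _ :&: _ = E :&: pg_edges (H j)) //; apply/setP=> d; rewrite !in_setI in_setD1.
case: (eqVneq d e) => [->|] //=; rewrite eE /=.
by apply/esym; apply: contra_neqF ij => /(part_edge_uniq ei).
Qed.

(** A spanning tree is determined by its traces on the blocks, and any choice of spanning trees of
    the blocks glues to one of the whole graph. *)
Lemma kappa_partition : kappa G = (\prod_i kappa (H i))%N.
Proof.
pose F i := [set E | spanning_tree (H i) (pg_edges (H i)) E].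
transitivity #|family (fun i => mem (F i))|; last first.
  by rewrite card_family foldrE big_map big_enum.
rewrite kappaE /complexity.
pose res (E : {set {set gT}}) := [ffun i => E :&: pg_edges (H i)].
have resE (E : {set {set gT}}) : E \subset pg_edges G -> E = \bigcup_i res E i.
  move=> EG; apply/setP=> e; apply/idP/bigcupP => [eE | [i _]].
    have [i ei] := part_edges (subsetP EG _ eE).
    by exists i; rewrite // ffunE inE eE.
  by rewrite ffunE inE => /andP[].
rewrite -(@card_in_imset _ _ res) => [|D E]; last first.
  rewrite !inE => /and3P[DG _ _] /and3P[EG _ _] DE.
  by rewrite (resE _ DG) DE -resE.
apply: eq_card => f; apply/imsetP/familyP => [[E + ->] i | fF].
  rewrite inE => tE; have /and3P[EG _ _] := tE.
  move: tE; rewrite part_spanning_tree // => /forallP/(_ i).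
  by rewrite ffunE inE.
have fi i : f i \subset pg_edges (H i) by have := fF i; rewrite inE => /and3P[].
have fU : \bigcup_i f i \subset pg_edges G.
  by apply/bigcupsP=> i _; apply: subset_trans (fi i) (part_edges_sub i).
have fE i : (\bigcup_i f i) :&: pg_edges (H i) = f i.
  apply/setP=> e; rewrite inE; apply/andP/idP => [[/bigcupP[j _ ej] ei]|ei].
    by rewrite -(part_edge_uniq (subsetP (fi j) _ ej) ei).
  by split; [apply/bigcupP; exists i | apply: subsetP (fi i) _ ei].
exists (\bigcup_i f i); last by apply/ffunP=> i; rewrite ffunE fE.
rewrite inE part_spanning_tree //; apply/forallP=> i; rewrite fE.
by have := fF i; rewrite inE.
Qed.

End GroupPartition.

(** The subgroups of a cyclic p-group form a chain, so the power graph is complete and Cayley's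
    formula applies. *)
Lemma kappa_cyclic_pgroup (gT : finGroupType) (p : nat) (G : {group gT}) :
  p.-group G -> cyclic G -> kappa G = (#|G| ^ (#|G| - 2))%N.
Proof.
move=> pG cG; rewrite kappaE -complexity_complete_on ?cardG_gt0 //.
congr (complexity _ _); apply/setP=> e; rewrite [RHS]inE; apply/pg_edgesP/andP.
  by case=> x [y [xG yG /andP[xy _] ->]]; rewrite subUset !sub1set xG cards2 xy.
case=> eG /cards2P[x [y [xy eE]]]; exists x, y.
move: eG; rewrite eE subUset !sub1set => /andP[xG yG]; split=> //.
have [sx sy] : <[x]> \subset G /\ <[y]> \subset G by rewrite !cycle_subG.
rewrite /pg_adj xy /= -(cardSg_cyclic cG sx sy) -(cardSg_cyclic cG sy sx).
have [a ->] := p_natP (pgroupS sx pG); have [b ->] := p_natP (pgroupS sy pG).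
by case: (leqP a b) => [/(dvdn_exp2l p)-> //|/ltnW/(dvdn_exp2l p)->]; rewrite orbT.
Qed.

Lemma kappa_exponent_prime (gT : finGroupType) (p : nat) (G : {group gT}) :
  prime p -> exponent G %| p ->
  kappa G = ((p ^ (p - 2)) ^ (#|G|.-1 %/ p.-1))%N.
Proof.
move=> pr_p expG.
have oG x : x \in G^# -> #[x] = p.
  rewrite !inE => /andP[x1 xG]; apply/prime_nt_dvdP => //; first by rewrite order_eq1.
  exact: dvdn_trans (dvdn_exponent xG) expG.
pose P := [set <[x]>%G | x in G^#].
have oP K : K \in P -> #|K| = p by case/imsetP=> x xG ->; rewrite -[#|_|]/#[x] oG.
have sP K : K \in P -> K \subset G.
  by case/imsetP=> x; rewrite !inE => /andP[_ xG] ->; rewrite cycle_subG.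
have tiP K L : K \in P -> L \in P -> K != L -> K :&: L = 1.
  move=> KP LP KL; have prK : prime #|K| by rewrite oP.
  apply: prime_TIg => //; apply: contra KL => sKL.
  by rewrite -val_eqE eqEcard sKL !oP //=.
(* The family is indexed by all subgroups; those outside [P] are replaced by the trivial group,
   which contributes a factor 1. *)
pose H (K : {group gT}) := if K \in P then K else 1%G.
have cov : \bigcup_K H K = G :> {set gT}.
  apply/eqP; rewrite eqEsubset; apply/andP; split.
    by apply/bigcupsP=> K _; rewrite /H; case: ifP => [/sP//|_]; apply: sub1G.
  apply/subsetP=> x xG; apply/bigcupP; case: (eqVneq x 1) => [->|x1].
    by exists 1%G.
  exists <[x]>%G => //; rewrite /H (_ : _ \in P) ?cycle_id //.
  by apply/imsetP; exists x; rewrite ?inE ?x1.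
have ti K L : K != L -> H K :&: H L = 1.
  move=> KL; rewrite /H; case: ifP => KP; case: ifP => LP; rewrite ?setIg1 ?setI1g //.
  exact: tiP.
rewrite (kappa_partition cov ti) (bigID (mem P)) /= [X in (_ * X)%N]big1 ?muln1; last first.
  move=> K /negPf KP; rewrite /H KP (@kappa_cyclic_pgroup _ 2) ?cards1 ?cyclic1 //.
  exact: pgroup1.
rewrite (eq_bigr (fun=> p ^ (p - 2))%N) => [|K KP]; last first.
  by rewrite /H KP (@kappa_cyclic_pgroup _ p) ?oP // ?prime_cyclic ?oP // /pgroup oP ?pnat_id.
rewrite prod_nat_const; congr (_ ^ _)%N; apply/esym.
have p1 : 0 < p.-1 by case: p pr_p {expG oG oP} => [|[]].
suff -> : #|G|.-1 = (#|P| * p.-1)%N by rewrite mulnK.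
(* The non-identity elements fall into classes of size [p - 1], one for each member of [P]. *)
pose Q := [set (K : {group gT})^# | K in P].
have partQ : partition Q G^#.
  apply/and3P; split.
  - apply/eqP/setP=> x; apply/bigcupP/idP => [[_ /imsetP[K KP ->]]|xG].
      by rewrite !inE => /andP[-> /(subsetP (sP K KP))].
    have KP : <[x]>%G \in P by apply/imsetP; exists x.
    exists (<[x]>^#); first by apply/imsetP; exists <[x]>%G.
    by move: xG; rewrite !inE cycle_id andbT => /andP[].
  - apply/trivIsetP=> _ _ /imsetP[K KP ->] /imsetP[L LP ->] KL.
    have KNL : K != L by apply: contraNneq KL => ->.
    rewrite -setI_eq0; apply/eqP/setP=> z; have /setP/(_ z) := tiP K L KP LP KNL.
    by rewrite !inE; case: (z == 1); case: (z \in K); case: (z \in L).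
  - apply/negP=> /imsetP[K KP /esym/eqP]; rewrite setD_eq0 => sK1.
    have := subset_leq_card sK1; rewrite cards1 oP //.
    by rewrite leqNgt prime_gt1.
have injQ : {in P &, injective (fun K : {group gT} => K^#)}.
  by move=> K L _ _ KL; apply/val_inj; rewrite /= -(setD1K (group1 K)) KL setD1K ?group1.
have := @card_uniform_partition _ p.-1 Q G^# _ partQ.
rewrite (cardsD1 1 G) group1 /= card_in_imset // => -> // _ /imsetP[K KP ->].
by have := oP K KP; rewrite (cardsD1 1 K) group1 => <-.
Qed.

(** [M] is normal of index 2, so it meets the simple group ['Alt_T] trivially or contains it. A
    trivial intersection would give a product set of more than [#|T|!] elements; otherwise the
    orders agree. *)
Lemma index2_Sym (T : finType) (M : {group {perm T}}) :
  4 < #|T| -> (2 * #|M| = #|T|`!)%N -> M :=: 'Alt_T.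
Proof.
move=> T5 oM; have oA := card_Alt (ltn_trans (isT : 1 < 4) T5).
have MA : #|M| = #|'Alt_T| by apply/eqP; rewrite -(eqn_pmul2l (isT : 0 < 2)) oM oA.
have nM : M <| 'Sym_T.
  apply: index2_normal (subsetT _) _; rewrite -divgS ?subsetT // card_Sym -oM mulnK //.
have nMA : 'Alt_T :&: M <| 'Alt_T by apply: normalGI (subsetT _) nM.
have /simpleP[_ /(_ _ nMA)[MA1|MAA]] := simple_Alt5 T5.
  have : #|M * 'Alt_T| <= #|'Sym_T| by apply: subset_leq_card (subsetT _).
  rewrite TI_cardMg 1?setIC // card_Sym -oA MA leq_pmul2r ?cardG_gt0 // -MA.
  rewrite leqNgt -(ltn_pmul2l (isT : 0 < 2)) oM; case/negP.
  exact: leq_trans (isT : 4 < 5`!) (leq_fact T5).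
by apply/esym/eqP; rewrite eqEcard MA leqnn andbT -{1}MAA subsetIr.
Qed.

(** * The permutation action on the cosets of a subgroup *)

Section CosetAction.

Variables (gT : finGroupType) (G H : {group gT}).
Hypothesis sHG : H \subset G.

Local Notation A := (rcosets H G).

Lemma rcoset_id_mem : gval H \in A.
Proof. by apply/rcosetsP; exists 1; rewrite ?group1 ?mulg1. Qed.

(** Right translation of cosets, renumbered by ordinals so that the image consists of permutations
    of ['I_m]. Elements outside [G] fix everything, because an action must be injective for every
    element of the type. *)
Definition coset_act (i : 'I_#|G : H|) (g : gT) : 'I_#|G : H| :=
  if g \in G then enum_rank_in rcoset_id_mem ((enum_val i : {set gT}) :* g) else i.

Lemma rcosets_stable g (X : {set gT}) : g \in G -> X \in A -> X :* g \in A.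
Proof.
move=> gG /rcosetsP[x xG ->]; rewrite -rcosetM; apply/rcosetsP.
by exists (x * g); rewrite ?groupM.
Qed.

Lemma coset_act_val i g : g \in G -> enum_val (coset_act i g) = (enum_val i : {set gT}) :* g.
Proof.
by move=> gG; rewrite /coset_act gG enum_rankK_in // rcosets_stable // enum_valP.
Qed.

Lemma coset_act_is_action : is_action G coset_act.
Proof.
split=> [g i j|i g h gG hG].
  case gG: (g \in G); last by rewrite /coset_act gG.
  move/(congr1 enum_val); rewrite !coset_act_val // => /rcoset_inj.
  exact: enum_val_inj.
by apply: enum_val_inj; rewrite !coset_act_val ?groupM // rcosetM.
Qed.

Canonical coset_action := Action coset_act_is_action.

(** The kernel of the action is the core of [H], and the condition on orders says that the image has
    index 2 in the symmetric group. *)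
Lemma isog_coset_Alt m : #|G : H| = m -> 4 < m ->
  (2 * #|G| = m`! * #|gcore H G|)%N -> G / gcore H G \isog 'Alt_('I_m).
Proof.
move=> <- m5 oG.
have gcG : gcore H G \subset G by apply: subset_trans (gcore_sub _ _) sHG.
have kerE : 'ker (actperm coset_action) = gcore H G.
  apply/setP=> g; rewrite -astabRs_rcosets ker_actperm.
  apply/idP/idP => [gC|].
    have gG : g \in G by apply: astab_dom gC.
    apply/astabP=> X XA; have := astab_act gC (in_setT (enum_rank_in rcoset_id_mem X)).
    move/(congr1 enum_val); rewrite /= coset_act_val // enum_rankK_in // => e.
    by rewrite -[RHS]e; apply: rcosetE.
  rewrite astabRs_rcosets => gC; have gG := subsetP gcG _ gC.
  rewrite -astabRs_rcosets in gC; rewrite in_setI gG inE; apply/subsetP=> i _.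
  rewrite inE; apply/eqP; apply: enum_val_inj.
  by rewrite /= coset_act_val // -rcosetE; apply: (astab_act gC); apply: enum_valP.
have iso : G / gcore H G \isog actperm coset_action @* G.
  rewrite -kerE; exact: first_isog.
have oIm : (2 * #|actperm coset_action @* G| = #|G : H|`!)%N.
  apply/eqP; rewrite -(eqn_pmul2r (cardG_gt0 (gcore H G))) -oG -mulnA -(card_isog iso).
  by rewrite card_quotient ?gcore_norm // [X in (2 * X)%N]mulnC Lagrange.
have := @index2_Sym _ (actperm coset_action @* G)%G; rewrite card_ord => /(_ m5 oIm) /= ME.
have isoM : gval (actperm coset_action @* G)%G \isog 'Alt_('I_#|G : H|).
  by rewrite /= ME isog_refl.
exact: isog_trans iso isoM.
Qed.

End CosetAction.

Local Open Scope ring_scope.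

(** * The partition of L_2(q) *)

(** The coefficient [k] is a certificate that the goal is a multiple of the hypothesis; what remains
    is an identity for [ring]. *)
Lemma lincomb1 (R : comRingType) (k u v a b : R) :
  u = v -> a - b = k * (u - v) -> a = b.
Proof. by move=> ->; rewrite subrr mulr0 => /subr0_eq. Qed.

Lemma lincomb2 (R : comRingType) (k k' u v u' v' a b : R) :
  u = v -> u' = v' -> a - b = k * (u - v) + k' * (u' - v') -> a = b.
Proof. by move=> -> ->; rewrite !subrr !mulr0 addr0 => /subr0_eq. Qed.

Lemma ord2_case (k : 'I_2) : k = 0 \/ k = 1.
Proof. by case: k => [[|[|k]] ltk] //; [left | right]; apply: val_inj. Qed.

(** * SL(2,q) in terms of matrix entries: centre and order *)

Section Entries.

Variable F : finFieldType.
Implicit Types (x y : {'GL_2[F]}).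

Definition ent11 x : F := GLval x 0 0.
Definition ent12 x : F := GLval x 0 1.
Definition ent21 x : F := GLval x 1 0.
Definition ent22 x : F := GLval x 1 1.

Lemma mx2_mulE (A B : 'M[F]_2) i j : (A *m B) i j = A i 0 * B 0 j + A i 1 * B 1 j.
Proof.
rewrite !mxE !big_ord_recl big_ord0 addr0.
by congr (_ + A i _ * B _ j); apply: val_inj.
Qed.

Lemma mx2_detE (A : 'M[F]_2) : \det A = A 0 0 * A 1 1 - A 0 1 * A 1 0.
Proof.
rewrite (expand_det_row _ 0) !big_ord_recl big_ord0 addr0 /cofactor !det_mx11 !mxE /=.
rewrite expr0 expr1 mul1r mulN1r mulrN.
by congr (_ * A _ _ - A _ _ * A _ _); apply: val_inj.
Qed.

Lemma GL2_eq x y : ent11 x = ent11 y -> ent12 x = ent12 y ->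
  ent21 x = ent21 y -> ent22 x = ent22 y -> x = y.
Proof.
move=> e11 e12 e21 e22; apply: val_inj; apply/matrixP => i j.
by case: (ord2_case i) => ->; case: (ord2_case j) => ->.
Qed.

Lemma ent11M x y : ent11 (x * y)%g = ent11 x * ent11 y + ent12 x * ent21 y.
Proof. exact: mx2_mulE. Qed.
Lemma ent12M x y : ent12 (x * y)%g = ent11 x * ent12 y + ent12 x * ent22 y.
Proof. exact: mx2_mulE. Qed.
Lemma ent21M x y : ent21 (x * y)%g = ent21 x * ent11 y + ent22 x * ent21 y.
Proof. exact: mx2_mulE. Qed.
Lemma ent22M x y : ent22 (x * y)%g = ent21 x * ent12 y + ent22 x * ent22 y.
Proof. exact: mx2_mulE. Qed.

Definition entM := (ent11M, ent12M, ent21M, ent22M).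

Lemma ent11_1 : ent11 1%g = 1. Proof. by rewrite /ent11 GL_1E mxE. Qed.
Lemma ent12_1 : ent12 1%g = 0. Proof. by rewrite /ent12 GL_1E mxE. Qed.
Lemma ent21_1 : ent21 1%g = 0. Proof. by rewrite /ent21 GL_1E mxE. Qed.
Lemma ent22_1 : ent22 1%g = 1. Proof. by rewrite /ent22 GL_1E mxE. Qed.

Definition ent1 := (ent11_1, ent12_1, ent21_1, ent22_1).

Lemma SL2P x : reflect (ent11 x * ent22 x - ent12 x * ent21 x = 1) (x \in SL 1 F).
Proof. by rewrite inE mx2_detE; apply: eqP. Qed.

Lemma SL2_ex a b c d : a * d - b * c = 1 -> exists2 x, x \in SL 1 F &
  [/\ ent11 x = a, ent12 x = b, ent21 x = c & ent22 x = d].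
Proof.
move=> det1; pose A : 'M[F]_2 :=
  \matrix_(i, j) if i == 0 then if j == 0 then a else b else if j == 0 then c else d.
have detA : \det A = 1 by rewrite mx2_detE !mxE.
have uA : A \is a GRing.unit by rewrite -[_ \is a _]/(A \in unitmx) unitmxE detA unitr1.
pose x : {'GL_2[F]} := Sub A uA.
have xE : GLval x = A by exact: SubK.
by exists x; rewrite ?inE /ent11 /ent12 /ent21 /ent22 xE ?detA // !mxE.
Qed.

(** Commuting with the two elementary unipotent matrices already forces a matrix to be scalar. *)
Lemma SL2_centerP x : reflect
  [/\ x \in SL 1 F, ent12 x = 0, ent21 x = 0 & ent11 x = ent22 x]
  (x \in 'Z(SL 1 F)).
Proof.
apply: (iffP (centerP _ _)) => [[xS cx]|[xS x12 x21 x1122]]; split=> //; last first.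
- move=> y _; apply: GL2_eq; rewrite !entM ?x12 ?x21 ?x1122; ring.
all: have [u uS [u11 u12 u21 u22]] : exists2 y, y \in SL 1 F &
    [/\ ent11 y = 1, ent12 y = 1, ent21 y = 0 & ent22 y = 1] by apply: SL2_ex; ring.
all: have [l lS [l11 l12 l21 l22]] : exists2 y, y \in SL 1 F &
    [/\ ent11 y = 1, ent12 y = 0, ent21 y = 1 & ent22 y = 1] by apply: SL2_ex; ring.
all: have cu := cx u uS; have cl := cx l lS.
- have := congr1 ent12 cu; rewrite !entM !(u11, u12, u21, u22) => e.
  by apply: (lincomb1 (k := 1) e); ring.
- have := congr1 ent11 cu; rewrite !entM !(u11, u12, u21, u22) => e.
  by apply: (lincomb1 (k := -1) e); ring.
- have := congr1 ent11 cl; rewrite !entM !(l11, l12, l21, l22) => e.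
  by apply: (lincomb1 (k := 1) e); ring.
Qed.

(** [SL 1 F] is the kernel of the determinant on ['GL_2[F]], whose image is the whole group of
    [q - 1] units, as the matrices diag(t, 1) show. *)
Lemma card_SL2 : #|SL 1 F| = (#|F| * (#|F| ^ 2 - 1))%N.
Proof.
pose q := #|F|; have q1 : (1 < q)%N := finNzRing_gt1 F.
have -> : (q * (q ^ 2 - 1) = q * q.-1 * q.+1)%N 
  by rewrite -mulnA -(subn1 q) -(addn1 q) -(subn_sqr q 1) exp1n.
have q0 : (0 < q.-1)%N by rewrite -subn1 subn_gt0.
apply/eqP; rewrite -(eqn_pmul2r q0).
have -> : (q * q.-1 * q.+1 * q.-1 = #|'GL_2[F]%g|)%N.
  by rewrite card_GL_2 -/q -mulnn -!mulnA (mulnC q.+1).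
have Udet (x : {'GL_2[F]}) : \det (GLval x) \is a GRing.unit by rewrite unitfE GL_det.
pose f (x : {'GL_2[F]}) : {unit F} := FinRing.unit F (Udet x).
have fM : {in 'GL_2[F] &, {morph f : x y / (x * y)%g}}.
  by move=> x y _ _; apply: val_inj; rewrite /= det_mulmx.
have kerf : 'ker (Morphism fM) = SL 1 F.
  by apply/setP=> x; rewrite !inE -val_eqE.
have imf : (Morphism fM @* 'GL_2[F])%g = [set: {unit F}].
  apply/setP=> t; rewrite !inE; apply/morphimP.
  have Ut : (val t != 0) by rewrite -unitfE; apply: (valP t).
  pose A : 'M[F]_2 := diag_mx (\row_i if i == 0 then val t else 1).
  have detA : \det A = val t by rewrite mx2_detE !mxE /= !mulr1n mulr0n mul0r subr0 mulr1.
  have uA : A \is a GRing.unit.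
    by rewrite -[_ \is a _]/(A \in unitmx) unitmxE detA unitfE.
  exists (Sub A uA : {'GL_2[F]}); rewrite ?inE //.
  by apply: val_inj; apply: (esym detA).
rewrite -(Lagrange (subsetT (SL 1 F))) -kerf eqn_mul2l; apply/orP; right.
have <- : #|[set: {unit F}]%g| = q.-1 by apply: card_finField_unit.
by rewrite -imf card_morphim setTI.
Qed.

End Entries.

(** * The subgroups of SL(2,q) attached to lines of matrices modulo scalars *)

Section MaximalAbelian.

Variable F : finFieldType.
Implicit Types (x y : {'GL_2[F]}).

(* The indices enumerate the points of the projective plane of matrices modulo
   scalars; index [i] stands for the 2-dimensional algebra spanned by 1 and
   [[0,1],[0,0]], [[1,b],[0,0]] or [[a,b],[1,0]] respectively. *)
Definition mx_line : finType := option (F + F * F)%type.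

Definition on_line (i : mx_line) x : bool :=
  match i with
  | None => (ent21 x == 0) && (ent11 x == ent22 x)
  | Some (inl b) => (ent21 x == 0) && (ent12 x == b * (ent11 x - ent22 x))
  | Some (inr ab) => (ent12 x == ab.2 * ent21 x) && (ent11 x == ab.1 * ent21 x + ent22 x)
  end.

Definition line_set i : {set {'GL_2[F]}} := [set x in SL 1 F | on_line i x].

Lemma mem_line_set i x : (x \in line_set i) = (x \in SL 1 F) && on_line i x.
Proof. by rewrite in_set. Qed.

Lemma line_group_set i : group_set (line_set i).
Proof.
apply/group_setP; split.
  rewrite mem_line_set group1 /=; case: i => [[b|[a b]]|] /=; rewrite !ent1;
  by rewrite ?subrr ?mulr0 ?add0r ?eqxx.
move=> x y; rewrite !mem_line_set => /andP[xS xi] /andP[yS yi]; rewrite groupM //=.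
move: xi yi; case: i => [[b|[a b]]|] /=.
- move=> /andP[/eqP x21 /eqP x12] /andP[/eqP y21 /eqP y12].
  by rewrite !entM x21 y21 x12 y12; apply/andP; split; apply/eqP; ring.
- move=> /andP[/eqP x12 /eqP x11] /andP[/eqP y12 /eqP y11].
  by rewrite !entM x12 y12 x11 y11; apply/andP; split; apply/eqP; ring.
- move=> /andP[/eqP x21 /eqP x11] /andP[/eqP y21 /eqP y11].
  by rewrite !entM x21 y21 x11 y11; apply/andP; split; apply/eqP; ring.
Qed.

Canonical line_group i := Group (line_group_set i).

Lemma mem_line i x : (x \in line_group i) = (x \in SL 1 F) && on_line i x.
Proof. exact: mem_line_set. Qed.

Lemma line_sub i : line_group i \subset SL 1 F.
Proof. by apply/subsetP=> x; rewrite mem_line => /andP[]. Qed.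

Lemma line_cover x : x \in SL 1 F -> exists i, x \in line_group i.
Proof.
move=> xS; case: (eqVneq (ent21 x) 0) => [x21|x21].
  case: (eqVneq (ent11 x - ent22 x) 0) => [x12|x12].
    by exists None; rewrite mem_line xS /= x21 eqxx -subr_eq0 x12 eqxx.
  exists (Some (inl (ent12 x / (ent11 x - ent22 x)))).
  by rewrite mem_line xS /= x21 eqxx divfK //=.
exists (Some (inr ((ent11 x - ent22 x) / ent21 x, ent12 x / ent21 x))).
by rewrite mem_line xS /= !divfK // eqxx /= subrK.
Qed.

Lemma center_sub_line i : 'Z(SL 1 F) \subset line_group i.
Proof.
apply/subsetP=> x /SL2_centerP[xS x12 x21 x11]; rewrite mem_line xS /=.
by case: i => [[b|[a b]]|] /=; rewrite ?x12 x21 x11 ?subrr ?mulr0 ?add0r !eqxx.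
Qed.

(** Distinct lines modulo scalars meet in zero only, so a common element is scalar. *)
Lemma line_TI i j : i != j -> line_group i :&: line_group j = 'Z(SL 1 F).
Proof.
move=> ij; apply/eqP; rewrite eqEsubset subsetI !center_sub_line !andbT.
apply/subsetP=> x; rewrite in_setI !mem_line => /andP[/andP[xS xi] /andP[_ xj]].
apply/SL2_centerP; move: xi xj ij.
have central0 b : ent21 x = 0 -> ent12 x = b * (ent11 x - ent22 x) ->
    ent11 x = ent22 x -> [/\ x \in SL 1 F, ent12 x = 0, ent21 x = 0 & ent11 x = ent22 x].
  by move=> x21 x12 x11; split; rewrite // x12 x11 subrr mulr0.
have central1 a b : ent21 x = 0 -> ent12 x = b * ent21 x ->
    ent11 x = a * ent21 x + ent22 x ->
    [/\ x \in SL 1 F, ent12 x = 0, ent21 x = 0 & ent11 x = ent22 x].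
  by move=> x21 x12 x11; split; rewrite // ?x12 ?x11 x21 mulr0 ?add0r.
case: i => [[b|[a b]]|] /= /andP[/eqP xi1 /eqP xi2];
case: j => [[b'|[a' b']]|] /= /andP[/eqP xj1 /eqP xj2] ij.
- apply: (central0 b) => //; apply/eqP; rewrite -subr_eq0; apply: contraNT ij => nz.
  by rewrite -(mulIf nz (etrans (esym xi2) xj2)).
- exact: (central1 a' b').
- exact: (central0 b).
- exact: (central1 a b).
- apply: (central1 a b) => //; apply/eqP; apply: contraNT ij => nz.
  rewrite -(mulIf nz (etrans (esym xi1) xj1)).
  by rewrite -(mulIf nz (addIr _ (etrans (esym xi2) xj2))).
- exact: (central1 a b).
- exact: (central0 b').
- exact: (central1 a' b').
- by [].
Qed.

Local Notation q := #|F|.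
Local Notation Z := 'Z(SL 1 F).

Lemma card_mx_line : #|{: mx_line}| = (q ^ 2 + q).+1.
Proof. by rewrite card_option card_sum card_prod addnC mulnn. Qed.

(** A non-central element is counted once, a central one on each of the q^2 + q + 1 lines. *)
Lemma sum_card_lines :
  (\sum_i #|line_group i| = #|SL 1 F| + #|Z| * (q ^ 2 + q))%N.
Proof.
have cardD i : #|line_group i| = (#|Z| + #|line_group i :\: Z|)%N.
  by rewrite -(cardsID Z (line_group i)) (setIidPr (center_sub_line i)).
rewrite (eq_bigr _ (fun i _ => cardD i)) big_split /= sum_nat_const card_mx_line.
rewrite -(cardsID Z (SL 1 F)) (setIidPr (center_sub _)).
have -> : (\sum_i #|line_group i :\: Z| = #|SL 1 F :\: Z|)%N.
  have -> : SL 1 F :\: Z = \bigcup_i (line_group i :\: Z).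
    apply/setP=> x; rewrite in_setD; apply/andP/bigcupP => [[xZ /line_cover[i xi]]|[i _]].
      by exists i; rewrite // in_setD xZ.
    by rewrite in_setD => /andP[xZ /(subsetP (line_sub i))].
  rewrite -[RHS]sum1_card partition_disjoint_bigcup /=.
    by apply: eq_bigr => i _; rewrite sum1_card.
  move=> i j /line_TI ijZ; rewrite -setI_eq0; apply/eqP/setP=> x.
  have /setP/(_ x) := ijZ; move=> Zx; rewrite in_setI !in_setD in_set0 -Zx.
  by rewrite in_setI; case: (x \in line_group i); case: (x \in line_group j).
by rewrite mulSn mulnC -!addnA; congr (_ + _)%N; rewrite addnC.
Qed.

Definition PSL_line i := (line_group i / Z)%G.

Lemma PSL_line_cover : \bigcup_i PSL_line i = PSL 1 F :> {set _}.
Proof.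
apply/eqP; rewrite eqEsubset; apply/andP; split.
  by apply/bigcupsP=> i _; rewrite quotientS ?line_sub.
apply/subsetP=> _ /morphimP[x xN xS ->]; have [i xi] := line_cover xS.
by apply/bigcupP; exists i => //; apply: mem_morphim.
Qed.

Lemma PSL_line_TI i j : i != j -> PSL_line i :&: PSL_line j = 1%g.
Proof.
by move=> ij; rewrite -quotientGI ?center_sub_line // line_TI // trivg_quotient.
Qed.

Lemma card_PSL_line i : #|PSL_line i| = (#|line_group i| %/ #|Z|)%N.
Proof.
rewrite card_quotient ?divgS ?center_sub_line //.
by apply: subset_trans (line_sub i) _; apply: gFnorm.
Qed.

(** The scalar matrix of [e] has determinant e^2. *)
Lemma card_Z_sqr1 : #|Z| = #|[set e : F | e ^+ 2 == 1]|.
Proof.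
rewrite -(@card_in_imset _ _ (@ent11 F) Z).
  apply: eq_card => e; rewrite inE; apply/imsetP/eqP => [[x + ->]|e2].
    by case/SL2_centerP=> /SL2P <- -> -> ->; ring.
  have [|x xS [x11 x12 x21 x22]] := @SL2_ex F e 0 0 e; first by rewrite -e2; ring.
  by exists x => //; apply/SL2_centerP; rewrite x11 x12 x21 x22.
move=> x y /SL2_centerP[_ x12 x21 x11] /SL2_centerP[_ y12 y21 y11] e.
by apply: GL2_eq; rewrite // ?x12 ?y12 ?x21 ?y21 // -x11 -y11.
Qed.

(** The square roots of 1 are 1 and -1, which coincide exactly in characteristic 2, that is, for
    even [q]. *)
Lemma card_Z p n : prime p -> (0 < n)%N -> q = (p ^ n)%N -> #|Z| = gcdn q.-1 2.
Proof.
move=> pr_p n0 qE; have chF := card_finPcharP qE pr_p.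
have q0 : (0 < q)%N by apply/card_gt0P; exists 0.
have -> : gcdn q.-1 2 = if odd q then 2%N else 1%N.
  rewrite gcdnC -{2}(prednK q0) oddS; case: ifP => oq.
    by apply/gcdn_idPl; rewrite dvdn2.
  by apply/eqP; rewrite -/(coprime 2 _) coprime2n; move/negbFE: oq.
rewrite card_Z_sqr1 (_ : [set _ | _] = [set 1; -1]); last first.
  by apply/setP=> e; rewrite !inE sqrf_eq1.
rewrite cards2 qE oddX eqn0Ngt n0 /=.
case: (eqVneq p 2%N) chF => [-> chF | p2 chF].
  by rewrite oppr_pchar2 // eqxx.
have op : odd p by case: (even_prime pr_p) => // pE; rewrite pE in p2.
rewrite op (_ : 1 != -1 :> F) //; apply: contraNneq p2 => e.
have : 2%N \in [pchar F] by rewrite inE /= -[2%:R]/(1 + 1) {1}e addNr.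
by rewrite (pcharf_eq chF) inE eq_sym.
Qed.

End MaximalAbelian.

(** A faithful character embeds [G] in the units of a field, where finite subgroups are cyclic; a
    generator then has order dividing [N]. *)
Lemma cyclic_char (gT : finGroupType) (G : {group gT}) (L : fieldType) (f : gT -> L) (N : nat) :
  {in G &, {morph f : x y / (x * y)%g >-> x * y}} ->
  f 1%g = 1 -> {in G, forall x, f x = 1 -> x = 1%g} -> {in G, forall x, f x ^+ N = 1} ->
  cyclic G /\ (#|G| %| N)%N.
Proof.
move=> fM f1 finj fN.
have cG : cyclic G by apply: (field_mul_group_cyclic fM) => x xG; split=> [/finj->|->].
split=> //; have /cyclicP[x Gx] := cG; have xG : x \in G by rewrite Gx cycle_id.
have fX k : f (x ^+ k)%g = f x ^+ k.
  by elim: k => [|k IHk]; rewrite ?f1 // expgS exprS fM ?groupX // IHk.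
rewrite Gx order_dvdn; apply/eqP; apply: finj; first by rewrite groupX.
by rewrite fX fN.
Qed.

(** * Lines with two, one or no eigenlines *)

Section LineTypes.

Variable F : finFieldType.
Local Notation q := #|F|.
Local Notation Z := 'Z(SL 1 F).
Implicit Types (x y : {'GL_2[F]}) (a b r s : F) (i : mx_line F).

(* The number of fixed points on the projective line of the group of index [i]. *)
Definition n_fixed i : nat :=
  match i with
  | None => 1
  | Some (inl _) => 2
  | Some (inr ab) => #|[set r : F | r ^+ 2 == ab.1 * r + ab.2]|
  end.

Lemma root_setE a b r : r ^+ 2 = a * r + b ->
  [set s : F | s ^+ 2 == a * s + b] = [set r; a - r].
Proof.
move=> rE; apply/setP=> s; rewrite !inE -subr_eq0.
have -> : s ^+ 2 - (a * s + b) = (s - r) * (s - (a - r)).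
  by apply: (lincomb1 (k := 1) rE); ring.
by rewrite mulf_eq0 !subr_eq0.
Qed.

Lemma n_fixed_cases i : [|| n_fixed i == 0, n_fixed i == 1 | n_fixed i == 2]%N.
Proof.
case: i => [[b|[a b]]|] //=.
case: (set_0Vmem [set r : F | r ^+ 2 == a * r + b]) => [->|[r]]; first by rewrite cards0.
by rewrite inE => /eqP/root_setE->; rewrite cards2; case: (_ != _); rewrite ?orbT.
Qed.

(** The lines with one fixed point correspond to the points of the projective line: [Some r] gives
    the polynomial (X - r)^2, and [None] is the point at infinity. *)
Definition double_root_line (o : option F) : mx_line F :=
  omap (fun r => inr (r *+ 2, - r ^+ 2)) o.

Lemma n_fixed1 : [set i | n_fixed i == 1%N] = double_root_line @: setT.
Proof.
apply/setP=> i; rewrite inE; apply/idP/imsetP; last first.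
  case=> -[r|] _ -> //=; rewrite (@root_setE _ _ r); last by ring.
  by rewrite mulr2n addrK setUid cards1.
case: i => [[b|[a b]]|] //=; last by exists None.
case: (set_0Vmem [set r : F | r ^+ 2 == a * r + b]) => [->|[r]]; first by rewrite cards0.
rewrite inE => /eqP rE; rewrite (root_setE rE) cards2; case: (eqVneq r (a - r)) => // ra _.
exists (Some r) => //; congr (Some (inr (_, _))).
  by apply: (lincomb1 (k := -1) ra); ring.
by apply: (lincomb2 (k := -1) (k' := r) rE ra); ring.
Qed.

Lemma card_n_fixed1 : #|[set i | n_fixed i == 1%N]| = q.+1.
Proof.
rewrite n_fixed1 card_imset ?cardsT ?card_option // => -[r|] [s|] // [e1 e2].
congr Some; apply/eqP; rewrite -subr_eq0 -sqrf_eq0; apply/eqP.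
by apply: (lincomb2 (k := -1) (k' := - s) e2 e1); ring.
Qed.

(** For each [r] and each [a] exactly one [b] makes [r] a root, so the lines of type [inr]
    contribute q^2; the others contribute 2q and 1. *)
Lemma sum_n_fixed : (\sum_i n_fixed i = (q.+1) ^ 2)%N.
Proof.
rewrite (bigD1 None) //= (reindex_omap Some id) => [|[]//]; rewrite /= big_sumType /=.
rewrite (eq_bigl xpredT) => [|b]; last by rewrite eqxx.
rewrite [X in (_ + (_ + X))%N](eq_bigl xpredT) => [|ab]; last by rewrite eqxx.
have -> : (\sum_(ab : F * F) #|[set r : F | (r ^+ 2)%R == (ab.1 * r + ab.2)%R]| = q * q)%N.
  under eq_bigr => ab _ do rewrite -sum1_card.
  rewrite (exchange_big_dep xpredT) //= -sum_nat_const; apply: eq_bigr => r _.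
  rewrite sum1_card -[RHS]cardsT -[RHS](@card_imset _ _ (fun a => (a, r ^+ 2 - a * r)));
    last by move=> a b [].
  apply: eq_card => -[a b].
  rewrite unfold_in -[LHS]/(r \in [set s : F | s ^+ 2 == a * s + b]) inE.
  apply/eqP/imsetP => [rE|[c _ [-> ->]]].
    by exists a; rewrite // rE addrC addKr.
  by rewrite addrC subrK.
by rewrite sum_nat_const -mulnn mulSn mulnS; ring.
Qed.

(** Once the [q + 1] lines with one fixed point are removed from [sum_n_fixed], each remaining
    contribution is 2 or 0. *)
Lemma card_n_fixed2 : #|[set i | n_fixed i == 2%N]| = (q * q.+1 %/ 2)%N.
Proof.
have := sum_n_fixed; rewrite (bigID (fun i => n_fixed i == 1%N)) /=.
rewrite (eq_bigr (fun=> 1%N)) => [|i /eqP//]; rewrite sum1_card.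
have -> : #|[pred i | n_fixed i == 1%N]| = q.+1 by rewrite -card_n_fixed1 cardsE.
rewrite (bigID (fun i => n_fixed i == 2%N)) /= [X in (_ + (_ + X))%N]big1; last first.
  by move=> i; have := n_fixed_cases i; do 3!case: eqP.
rewrite (eq_bigl (fun i => i \in [set i | n_fixed i == 2%N])) => [|i]; last first.
  by rewrite !inE; case: eqP => // ->.
rewrite (eq_bigr (fun=> 2%N)) => [|i]; last by rewrite inE => /eqP.
rewrite sum_nat_const addn0 => e; rewrite (_ : q * q.+1 = #|[set i | n_fixed i == 2]| * 2)%N ?mulnK //.
by apply/eqP; rewrite -(eqn_add2l q.+1) e -mulnn mulSn.
Qed.

Lemma card_n_fixed0 : #|[set i | n_fixed i == 0%N]| = (q * q.-1 %/ 2)%N.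
Proof.
have q0 : (0 < q)%N by apply/card_gt0P; exists 0.
have e : (#|[set i | n_fixed i == 0%N]| + #|[set i | n_fixed i == 1%N]|
          + #|[set i | n_fixed i == 2%N]| = (q ^ 2 + q).+1)%N.
  rewrite -card_mx_line -!sum1dep_card -sum1_card [RHS](bigID (fun i => n_fixed i == 0%N)) /=.
  rewrite -addnA; congr (_ + _)%N; rewrite [RHS](bigID (fun i => n_fixed i == 1%N)) /=.
  congr (_ + _)%N; apply: eq_bigl => i; have := n_fixed_cases i; first by case: eqP => // ->.
  by do 3!case: eqP => //; move=> ->.
have dbl : (#|[set i | n_fixed i == 2%N]| * 2 = q * q.+1)%N.
  rewrite card_n_fixed2 divnK // dvdn2 oddM oddS andbN //.
rewrite (_ : q * q.-1 = #|[set i | n_fixed i == 0%N]| * 2)%N ?mulnK //.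
move: e dbl; rewrite card_n_fixed1; case: #|F| q0 => // m _; rewrite -mulnn /=.
move: #|[set i | n_fixed i == 0%N]| #|[set i | n_fixed i == 2%N]| => u v.
lia.
Qed.

Section Eigenvalue.

Variables (L : fieldType) (iota : {rmorphism F -> L}) (a b : F) (mu : L).
Hypothesis muE : mu ^+ 2 = iota a * mu + iota b.
Local Notation G := (line_group (Some (inr (a, b)))).

(** On this line x = ent22 + ent21 M with M = [[a,b],[1,0]], whose characteristic polynomial has the
    root [mu]; so this is an eigenvalue of [x]. The field [L] will be [F] itself or a quadratic
    extension. *)
Definition eigenv x : L := iota (ent22 x) + iota (ent21 x) * mu.

Lemma eigenvM : {in G &, {morph eigenv : x y / (x * y)%g >-> x * y}}.
Proof.
move=> x y; rewrite !mem_line => /and3P[_ /eqP x12 /eqP x11] /and3P[_ /eqP y12 /eqP y11].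
rewrite /eigenv !entM y12 y11 /=.
by apply: (lincomb1 (k := - iota (ent21 x) * iota (ent21 y)) muE); ring.
Qed.

Lemma eigenv1 : eigenv 1%g = 1.
Proof. by rewrite /eigenv !ent1 rmorph1 rmorph0 mul0r addr0. Qed.

(** The second root is [a - mu], and the product of the two eigenvalues is the determinant. *)
Lemma eigenv_norm : {in G, forall x,
  eigenv x * (iota (ent22 x) + iota (ent21 x) * (iota a - mu)) = 1}.
Proof.
move=> x; rewrite mem_line => /and3P[/SL2P + /eqP x12 /eqP x11].
rewrite /eigenv x12 x11 /= => /(congr1 iota) d.
by apply: (lincomb2 (k := - iota (ent21 x) ^+ 2) (k' := 1) muE d); ring.
Qed.

Lemma line_eq1 x : x \in G -> ent21 x = 0 -> ent22 x = 1 -> x = 1%g.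
Proof.
rewrite mem_line => /and3P[_ /eqP x12 /eqP x11] x21 x22.
by apply: GL2_eq; rewrite !ent1 // ?x12 ?x11 x21 ?mulr0 // add0r.
Qed.

End Eigenvalue.

(** An eigenvalue in [F] is a faithful character with values in the [q - 1] units. *)
Lemma line_split i : n_fixed i = 2%N -> cyclic (line_group i) /\ (#|line_group i| %| q.-1)%N.
Proof.
have q0 : (0 < q)%N by apply/card_gt0P; exists 0.
have unit_exp (u : F) : u != 0 -> u ^+ q.-1 = 1.
  by move=> u0; apply: (mulIf u0); rewrite mul1r -exprSr prednK // expf_card.
case: i => [[b|[a b]]|] //= => [_|].
  apply: (@cyclic_char _ _ _ (@ent11 F)) => [x y||x|x]; rewrite ?mem_line.
  - by move=> /and3P[_ /eqP x21 _] /and3P[_ /eqP y21 _]; rewrite entM y21 mulr0 addr0.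
  - exact: ent11_1.
  - move=> /and3P[/SL2P + /eqP x21 /eqP x12] x11; rewrite x21 x11 mulr0 subr0 mul1r => x22.
    by apply: GL2_eq; rewrite !ent1 // x12 x11 x22 subrr mulr0.
  - move=> /and3P[/SL2P + /eqP x21 _]; rewrite x21 mulr0 subr0 => d.
    by apply: unit_exp; apply: contra_eq_neq d => ->; rewrite mul0r eq_sym oner_eq0.
case: (set_0Vmem [set r : F | r ^+ 2 == a * r + b]) => [->|[r]]; first by rewrite cards0.
rewrite inE => /eqP rE; rewrite (root_setE rE) cards2; case: (eqVneq r (a - r)) => // ra _.
have norm := @eigenv_norm F idfun a b r rE.
apply: (@cyclic_char _ _ _ (@eigenv F idfun r)) => [|||x xG].
- exact: (@eigenvM _ idfun a b).
- exact: (@eigenv1 _ idfun).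
(* Both eigenvalues are 1, and their difference is [ent21 x] times the nonzero difference of the
   roots. *)
- move=> x xG fx; have := norm x xG; rewrite fx mul1r /= => fx'.
  have c0 : ent21 x = 0.
    apply/eqP; rewrite -(mulIr_eq0 _ (mulIf _ (x := r - (a - r)))) ?subr_eq0 //.
    apply/eqP; apply: (lincomb2 (k := 1) (k' := -1) fx fx'); rewrite /eigenv /=; ring.
  apply: (line_eq1 xG c0); by move: fx; rewrite /eigenv c0 mul0r addr0.
- apply: unit_exp; apply: contra_eq_neq (norm x xG) => ->.
  by rewrite mul0r eq_sym oner_eq0.
Qed.

(** Over a field [L] containing a root [mu], raising to the power [q] exchanges the two eigenvalues;
    the power [q + 1] of an eigenvalue is therefore the determinant, which is 1. *)
Lemma line_nonsplit p n i : prime p -> q = (p ^ n)%N -> n_fixed i = 0%N ->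
  cyclic (line_group i) /\ (#|line_group i| %| q.+1)%N.
Proof.
move=> pr_p qE; have chF := card_finPcharP qE pr_p.
case: i => [[b|[a b]]|] //= /eqP; rewrite cards_eq0 => /eqP no_root.
pose P : {poly F} := 'X^2 - (a *: 'X + b%:P).
have sP : size P = 3.
  rewrite size_polyDl ?size_polyXn // size_polyN.
  apply: leq_ltn_trans (size_polyD _ _) _; rewrite gtn_max.
  by rewrite (leq_ltn_trans (size_scale_leq _ _)) ?size_polyX // size_polyC; case: (b != 0).
have irrP : irreducible_poly P.
  apply: cubic_irreducible; first by rewrite sP.
  move=> r; apply/negP=> /rootP; rewrite !hornerE => /subr0_eq rE.
  by have := in_set0 r; rewrite -no_root inE rE eqxx.
have [L _ [mu /rootP muP _]] := irredp_FAdjoin irrP.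
pose iota : {rmorphism F -> L} := in_alg L.
have muE : mu ^+ 2 = iota a * mu + iota b.
  apply: subr0_eq; rewrite -muP rmorphB /= map_polyXn rmorphD /= map_polyZ /= map_polyX map_polyC.
  by rewrite !hornerE.
have chL : p \in [pchar L] by rewrite (fmorph_pchar iota).
have qnat : [pchar L].-nat q by rewrite qE pnatX pnatE // chL.
have iotaq c : iota c ^+ q = iota c by rewrite -rmorphXn expf_card.
have mu_notF c : mu != iota c.
  apply/eqP=> muc; have := in_set0 c; rewrite -no_root inE => /negP[].
  apply/eqP; apply: (fmorph_inj iota); rewrite rmorphXn rmorphD rmorphM.
  by rewrite -[in LHS]muc -[X in _ * X + _]muc.
have muq : mu ^+ q = iota a - mu.
  have muqE : (mu ^+ q) ^+ 2 = iota a * mu ^+ q + iota b.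
    by rewrite -exprM mulnC exprM muE exprDn_pchar // exprMn !iotaq.
  have : (mu ^+ q - mu) * (mu ^+ q - (iota a - mu)) = 0.
    by apply: (lincomb2 (k := 1) (k' := -1) muqE muE); ring.
  move/eqP; rewrite mulf_eq0 !subr_eq0 => /orP[/eqP muq|/eqP//].
  (* If mu^q = mu, then [mu] is a root of X^q - X, the product of all X - c with [c] in [F], and so
     lies in [F]. *)
  have /eqP : (\prod_c (mu - iota c)) = 0.
    have /(congr1 (fun R => (map_poly iota R).[mu])) := finField_genPoly F.
    rewrite rmorphB /= map_polyXn map_polyX !hornerE muq subrr => /esym.
    rewrite rmorph_prod horner_prod => <-; apply: eq_bigr => c _.
    by rewrite rmorphB /= map_polyX map_polyC !hornerE.
  rewrite prodf_seq_eq0 => /hasP[c _ /=]; rewrite subr_eq0 => /eqP muc.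
  by have := mu_notF c; rewrite muc eqxx.
have norm := eigenv_norm muE.
apply: (@cyclic_char _ _ _ (eigenv iota mu)) => [|||x xG].
- exact: eigenvM.
- exact: eigenv1.
(* With [ent21 x] nonzero, an eigenvalue 1 would express [mu] by elements of [F]. *)
- move=> x xG fx; have c0 : ent21 x = 0.
    apply/eqP; apply: contraT => c0.
    have := mu_notF ((1 - ent22 x) / ent21 x); case/eqP.
    have ic0 : iota (ent21 x) != 0 by rewrite fmorph_eq0.
    apply: (mulfI ic0); rewrite -rmorphM [ent21 x * _]mulrC divfK //.
    by apply: (lincomb1 (k := 1) fx); rewrite /eigenv; ring.
  apply: (line_eq1 xG c0); apply: (fmorph_inj iota).
  by move: fx; rewrite /eigenv c0 rmorph0 mul0r addr0 rmorph1.
- rewrite exprS -[RHS](norm x xG); congr (_ * _).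
  by rewrite /eigenv exprDn_pchar // exprMn !iotaq muq.
Qed.

(** Here x = e + cN with N^2 = 0 and e^2 = 1, and [h x] is c e = c / e, which is additive. The pair
    of [e] and [h] is injective, which bounds the order; since [h] takes values in characteristic p
    and vanishes only on the centre, p-th powers are central. *)
Lemma line_unipotent i : n_fixed i = 1%N ->
  (#|line_group i| <= #|Z| * q)%N /\
    (forall p, p \in [pchar F] -> (exponent (PSL_line i) %| p)%N).
Proof.
move=> i1.
have [h [e [hM h1 hZ e2 inj]]] : exists h, exists e,
   [/\ {in line_group i &, {morph h : x y / (x * y)%g >-> x + y}}, h 1%g = 0 :> F,
       {in line_group i, forall x, h x = 0 -> x \in Z},
       {in line_group i, forall x, e x ^+ 2 = 1 :> F} &
       {in line_group i &, forall x y, h x = h y -> e x = e y -> x = y}].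
  case: i i1 => [[b|[a b]]|] //=; last first.
    move=> _; exists (fun x => ent12 x * ent11 x), (@ent11 F).
    have det x : x \in line_group None ->
        [/\ x \in SL 1 F, ent21 x = 0, ent22 x = ent11 x & ent11 x ^+ 2 = 1].
      rewrite mem_line => /and3P[xS /eqP x21 /eqP x11]; split=> //.
      by have /SL2P <- := xS; rewrite x21 -x11; ring.
    split=> [x y /det[_ x21 x22 x2] /det[_ y21 y22 y2]||x /det[xS x21 x22 x2]|x /det[]//|].
    - rewrite !entM y21 y22.
      by apply: (lincomb2 (k := ent12 y * ent11 y) (k' := ent12 x * ent11 x) x2 y2); ring.
    - by rewrite !ent1 mul0r.
    - move/eqP; rewrite mulf_eq0 => /orP[/eqP x12|/eqP x11].
        by apply/SL2_centerP.
      by move: x2; rewrite x11 expr0n => /esym/eqP; rewrite oner_eq0.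
    - move=> x y /det[xS x21 x22 x2] /det[yS y21 y22 y2] + x11; rewrite x11 => xy.
      have y0 : ent11 y != 0 by apply: contra_eq_neq y2 => ->; rewrite expr0n eq_sym oner_eq0.
      by apply: GL2_eq; rewrite ?(mulIf y0 xy) ?x21 ?x22 ?y21 ?y22.
  case: (set_0Vmem [set r : F | r ^+ 2 == a * r + b]) => [->|[r]]; first by rewrite cards0.
  rewrite inE => /eqP rE; rewrite (root_setE rE) cards2; case: (eqVneq r (a - r)) => // ra _.
  have aE : a = r + r by apply: (lincomb1 (k := -1) ra); ring.
  pose e := @eigenv F idfun r; exists (fun x => ent21 x * e x), e.
  have e2 : {in line_group (Some (inr (a, b))), forall x, e x ^+ 2 = 1}.
    move=> x xG; rewrite -(@eigenv_norm F idfun a b r rE x xG) /= -ra.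
    by rewrite /e /eigenv /=; ring.
  have eM := @eigenvM F idfun a b r rE.
  have e0 x : x \in line_group (Some (inr (a, b))) -> e x != 0.
    by move/e2; apply: contra_eq_neq => ->; rewrite expr0n eq_sym oner_eq0.
  have eE x : ent22 x = e x - ent21 x * r by rewrite /e /eigenv /= addrK.
  split=> // [x y xG yG||x xG|x y xG yG].
  - move: (xG) (yG); rewrite !mem_line => /and3P[_ /eqP x12 /eqP x11] /and3P[_ /eqP y12 /eqP y11].
    rewrite /e eM // -/(e x) -/(e y) entM /= y11 /= (eE x) (eE y) aE.
    by apply: (lincomb2 (k := ent21 y * e y) (k' := ent21 x * e x) (e2 x xG) (e2 y yG)); ring.
  - by rewrite !ent1 mul0r.
  - move/eqP; rewrite mulf_eq0 (negPf (e0 x xG)) orbF => /eqP x21.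
    move: (xG); rewrite !mem_line => /and3P[xS /eqP x12 /eqP x11].
    by apply/SL2_centerP; rewrite x12 x11 x21 !mulr0 add0r.
  - move=> + exy; rewrite exy => /(mulIf (e0 y yG)) x21.
    move: xG yG; rewrite !mem_line => /and3P[_ /eqP x12 /eqP x11] /and3P[_ /eqP y12 /eqP y11].
    have x22 : ent22 x = ent22 y by rewrite !eE exy x21.
    by apply: GL2_eq; rewrite ?x12 ?y12 ?x11 ?y11 ?x21 ?x22.
split.
  rewrite card_Z_sqr1 -cardsT -cardsX.
  rewrite -(@card_in_imset _ _ (fun x => (e x, h x)) (line_group i)) => [|x y xG yG [exy hxy]].
    apply: subset_leq_card; apply/subsetP=> _ /imsetP[x xG ->].
    by rewrite !inE /= e2 ?eqxx.
  exact: inj.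
move=> p chF; apply/exponentP=> _ /morphimP[x xN xG ->].
rewrite -morphX //; apply: coset_id; apply: hZ; first by rewrite groupX.
suff -> : h (x ^+ p)%g = h x *+ p by rewrite -mulr_natr pcharf0 // mulr0.
elim: p {chF} => [|p IHp]; first by rewrite h1.
by rewrite expgS mulrS hM ?groupX ?IHp.
Qed.

End LineTypes.

Lemma kappa_ZE (gT : finGroupType) (G : {group gT}) : cyclic G -> kappa G = kappa_Z #|G|.
Proof.
move=> cG; rewrite /kappa_Z; apply: (@kappa_isog _ _ _ (Zp_group #|G|)).
rewrite isog_cyclic_card // card_Zp ?cardG_gt0 // eqxx andbT.
rewrite /= /Zp; case: ifP => _; last exact: cyclic1.
by apply/cyclicP; exists Zp1; rewrite Zp_cycle.
Qed.

(** * Orders of the parts and the formula for L_2(q) *)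

Section PSL2.

Variables (F : finFieldType) (p n : nat).
Hypotheses (pr_p : prime p) (n_gt0 : (0 < n)%N) (cardF : #|F| = (p ^ n)%N).
Local Notation q := #|F|.
Local Notation Z := 'Z(SL 1 F).

Lemma big_n_fixed (R : Type) (idx : R) (op : Monoid.com_law idx) (c : nat -> R) :
  \big[op/idx]_(i : mx_line F) c (n_fixed i) =
    op (\big[op/idx]_(i in [set i : mx_line F | n_fixed i == 0%N]) c 0%N)
       (op (\big[op/idx]_(i in [set i : mx_line F | n_fixed i == 1%N]) c 1%N)
           (\big[op/idx]_(i in [set i : mx_line F | n_fixed i == 2%N]) c 2%N)).
Proof.
rewrite (bigID (fun i => n_fixed i == 0%N)) /=; congr (op _ _).
  by apply: eq_big => [i|i /eqP->]; rewrite ?inE.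
rewrite (bigID (fun i => n_fixed i == 1%N)) /=; congr (op _ _).
  by apply: eq_big => [i|i /andP[_ /eqP->]]; rewrite ?inE //; case: (n_fixed i) => [|[|k]].
apply: eq_big => [i|i]; first by rewrite inE; have := n_fixed_cases i; case: (n_fixed i) => [|[|[|k]]].
by have := n_fixed_cases i; case: (n_fixed i) => [|[|[|k]]].
Qed.

Definition line_order (k : nat) : nat :=
  match k with 0 => q.+1 | 1 => #|Z| * q | _ => q.-1 end.

Lemma card_line (i : mx_line F) : #|line_group i| = line_order (n_fixed i).
Proof.
have q1 : (1 < q)%N := finNzRing_gt1 F.
have bound (j : mx_line F) : (#|line_group j| <= line_order (n_fixed j)
                 ?= iff (#|line_group j| == line_order (n_fixed j)))%N.
  split=> //; have := n_fixed_cases j => /or3P[]/eqP jE; rewrite jE /=.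
  - by apply: dvdn_leq => //; case: (line_nonsplit pr_p cardF jE).
  - by case: (line_unipotent jE).
  - by apply: dvdn_leq; [rewrite -subn1 subn_gt0 | case: (line_split jE)].
(* The sum of the bounds is reached only if every bound is, and the sum of the actual orders is
   known from [sum_card_lines]. *)
have [_] := leqif_sum (fun j (_ : xpredT j) => bound j).
rewrite sum_card_lines big_n_fixed /= !sum_nat_const.
rewrite card_n_fixed0 card_n_fixed1 card_n_fixed2 card_SL2.
set lhs := (X in (X == _) = _ -> _); set rhs := (X in (_ == X) = _ -> _).
suff -> : lhs = rhs by rewrite eqxx => /esym/forall_inP/(_ i isT)/eqP.
rewrite {}/lhs {}/rhs.
have e2 : ((q * q.+1 %/ 2) * 2 = q * q.+1)%N by rewrite divnK // dvdn2 oddM oddS andbN.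
have e0 : ((q * q.-1 %/ 2) * 2 = q * q.-1)%N.
  by rewrite divnK // dvdn2 oddM -{1}(prednK (ltnW q1)) oddS andNb.
move: (q * q.+1 %/ 2)%N (q * q.-1 %/ 2)%N e2 e0 => u v.
case: q q1 => // m _; rewrite /= -mulnn => e2 e0.
move: #|Z| => z.
(* Doubling replaces the two halved products by [q * q.+1] and [q * q.-1]. *)
suff : (2 * (m.+1 * (m.+1 * m.+1 - 1) + z * (m.+1 * m.+1 + m.+1)) =
       2 * (v * m.+2 + (m.+2 * (z * m.+1) + u * m)))%N by lia.
have -> : (2 * (v * m.+2 + (m.+2 * (z * m.+1) + u * m)) =
           (v * 2) * m.+2 + 2 * (m.+2 * (z * m.+1)) + (u * 2) * m)%N by ring.
rewrite e2 e0; have -> : (m.+1 * m.+1 - 1 = m * m.+2)%N by lia.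
ring.
Qed.

Lemma kappa_PSL_line (i : mx_line F) : kappa (PSL_line i) =
  match n_fixed i with
  | 0 => kappa_Z (q.+1 %/ #|Z|)
  | 1 => (p ^ (p - 2)) ^ (q.-1 %/ p.-1)
  | _ => kappa_Z (q.-1 %/ #|Z|)
  end%N.
Proof.
have cE := card_line i; have Z0 : (0 < #|Z|)%N := cardG_gt0 _.
case/or3P: (n_fixed_cases i) => /eqP iE; rewrite iE /= in cE *.
- have [cyc _] := line_nonsplit pr_p cardF iE.
  by rewrite kappa_ZE ?quotient_cyclic // card_PSL_line cE.
- have [_ /(_ p (card_finPcharP cardF pr_p)) expi] := line_unipotent iE.
  by rewrite (kappa_exponent_prime pr_p expi) card_PSL_line cE mulKn.
- have [cyc _] := line_split iE.
  by rewrite kappa_ZE ?quotient_cyclic // card_PSL_line cE.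
Qed.

Lemma kappa_L2 :
  kappa (L_ 2 F) = (p ^ ((q ^ 2 - 1) * (p - 2) %/ (p - 1))
    * kappa_Z (q.-1 %/ gcdn q.-1 2) ^ (q * q.+1 %/ 2)
    * kappa_Z (q.+1 %/ gcdn q.-1 2) ^ (q * q.-1 %/ 2))%N.
Proof.
rewrite (kappa_partition (PSL_line_cover F) (@PSL_line_TI F)).
rewrite (eq_bigr _ (fun i _ => kappa_PSL_line i)).
rewrite (big_n_fixed _ (fun k => match k with
  | 0 => kappa_Z (q.+1 %/ #|Z|)
  | 1 => (p ^ (p - 2)) ^ (q.-1 %/ p.-1)
  | _ => kappa_Z (q.-1 %/ #|Z|)
  end)%N) /= !prod_nat_const card_n_fixed0 card_n_fixed1 card_n_fixed2 -!(card_Z pr_p n_gt0 cardF).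
rewrite mulnC; congr (_ * _)%N; congr (_ * _)%N; rewrite -!expnM; congr (_ ^ _)%N.
have p1 : (0 < p.-1)%N by have := prime_gt1 pr_p; case: (p) => [|[]].
(* Each of the [q + 1] unipotent lines has exponent (p - 2)(q - 1)/(p - 1); as [p - 1] divides
   [q - 1], the truncated divisions are exact. *)
have dvd : (p.-1 %| q.-1)%N.
  by rewrite cardF -!subn1 -{2}(exp1n n) subn_exp dvdn_mulr.
rewrite -[(q ^ 2 - 1)%N]/(q ^ 2 - 1 ^ 2)%N subn_sqr !subn1 addn1.
rewrite -[in RHS](divnK dvd) -2![in RHS]mulnA [in RHS](mulnCA _ p.-1) mulKn //.
by rewrite mulnC mulnA.
Qed.

End PSL2.

(** * Exceptional isomorphisms *)

Section Arithmetic.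

Variables p al be : nat.
Local Open Scope nat_scope.

(* The number [a + p * b] with [a, b < p] encodes [a + b w] where [w^2 = al w + be];
   with [al = be = 0] the numbers below [p] also encode the prime field. *)
Definition code_add (x y : nat) : nat :=
  (x %% p + y %% p) %% p + p * ((x %/ p + y %/ p) %% p).

Definition code_mul (x y : nat) : nat :=
  let: (a, b, c, d) := (x %% p, x %/ p, y %% p, y %/ p) in
  (a * c + be * (b * d)) %% p + p * ((a * d + b * c + al * (b * d)) %% p).

(** The code [p.-1] stands for -1. *)
Definition code_sub (x y : nat) : nat := code_add x (code_mul p.-1 y).

(** Distinct codes below [q] have an invertible difference; as decoding respects the operations,
    this certifies that it is injective on them. *)
Definition code_field (q : nat) : bool :=
  all (fun x => all (fun y => (x == y) ||
     has (fun z => code_mul (code_sub x y) z == 1) (iota 0 q)) (iota 0 q)) (iota 0 q).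

Definition code := seq (seq nat).

Definition code_ent (c : code) (i j : nat) : nat := nth 0 (nth [::] c i) j.

Definition code_mx_mul (n : nat) (c d : code) : code :=
  mkseq (fun i => mkseq (fun j => foldr (fun k s =>
    code_add (code_mul (code_ent c i k) (code_ent d k j)) s) 0 (iota 0 n)) n) n.

Definition code_wf (n q : nat) (c : code) : bool :=
  (size c == n) && all (fun r => (size r == n) && all (fun x => x < q) r) c.

Definition code1 (n : nat) : code := mkseq (fun i => mkseq (fun j => (i == j) : nat) n) n.

End Arithmetic.

(** * Decoding numbers and matrices into [F] *)

Section Decoding.

Variables (F : finFieldType) (p al be : nat) (w : F).
Hypothesis chF : p \in [pchar F].
Hypothesis wE : w ^+ 2 = al%:R * w + be%:R.

Definition dec (x : nat) : F := (x %% p)%:R + (x %/ p)%:R * w.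

Lemma p_gt0 : (0 < p)%N.
Proof. by case/andP: chF => /prime_gt0. Qed.

Lemma dec_pair a b : dec (a %% p + p * (b %% p))%N = a%:R + b%:R * w.
Proof.
have p0 := p_gt0; rewrite /dec addnC mulnC modnMDl modn_mod divnMDl //.
by rewrite divn_small ?ltn_pmod // addn0 !(GRing.natr_mod_pchar chF).
Qed.

Lemma decD x y : dec (code_add p x y) = dec x + dec y.
Proof. by rewrite dec_pair /dec !natrD mulrDl addrACA. Qed.

Lemma decM x y : dec (code_mul p al be x y) = dec x * dec y.
Proof.
rewrite dec_pair /dec !(natrD, natrM).
apply: (lincomb1 (k := - (x %/ p)%:R * (y %/ p)%:R) wE); ring.
Qed.

Lemma dec0 : dec 0 = 0.
Proof. by rewrite /dec mod0n div0n mul0r addr0. Qed.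

Lemma dec1 : dec 1 = 1.
Proof.
by rewrite /dec modn_small ?divn_small ?mul0r ?addr0 //; case/andP: chF => /prime_gt1.
Qed.

Lemma decN1 : dec p.-1 = -1.
Proof.
have p0 := p_gt0; rewrite /dec modn_small ?divn_small ?prednK // mul0r addr0.
by apply/eqP; rewrite -addr_eq0 natr1 prednK // pcharf0.
Qed.

Lemma dec_inj q : code_field p al be q -> {in gtn q &, injective dec}.
Proof.
move=> /allP fld x y xq yq xy; have mem z : z \in gtn q -> z \in iota 0 q.
  by rewrite mem_iota.
have /allP/(_ y (mem y yq)) := fld x (mem x xq).
case/orP=> [/eqP//|/hasP[z _ /eqP /(congr1 dec)]].
by rewrite decM decD decM decN1 dec1 xy mulN1r subrr mul0r => /eqP; rewrite eq_sym oner_eq0.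
Qed.

Section Matrices.

Variable n : nat.

Definition decmx (c : code) : 'M[F]_n := \matrix_(i, j) dec (code_ent c i j).

Lemma decmxM c d : decmx (code_mx_mul p al be n c d) = decmx c *m decmx d.
Proof.
apply/matrixP=> i j; rewrite !mxE /code_ent !nth_mkseq //.
under eq_bigr => k _ do rewrite !mxE.
rewrite -(big_mkord xpredT (fun k => dec (code_ent c i k) * dec (code_ent d k j))).
rewrite /index_iota subn0; elim: (iota 0 n) => [|k s IHs] /=; first by rewrite dec0 big_nil.
by rewrite big_cons decD decM IHs.
Qed.

Lemma decmx1 : decmx (code1 n) = 1%:M.
Proof.
apply/matrixP=> i j; rewrite !mxE /code_ent !nth_mkseq // -[i == j]val_eqE /=.
by case: eqP => _; rewrite ?dec0 ?dec1.
Qed.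

Lemma decmx_inj q : code_field p al be q -> {in code_wf n q &, injective decmx}.
Proof.
move=> fld c d /andP[/eqP sc /allP wc] /andP[/eqP sd /allP wd] cd.
apply: (@eq_from_nth _ [::]); rewrite ?sc ?sd // => i ilt.
have /andP[/eqP sci /allP wci] := wc _ (mem_nth [::] (etrans (congr1 (leq i.+1) sc) ilt)).
have /andP[/eqP sdi /allP wdi] := wd _ (mem_nth [::] (etrans (congr1 (leq i.+1) sd) ilt)).
apply: (@eq_from_nth _ 0%N); rewrite ?sci ?sdi // => j jlt.
have := congr1 (fun A : 'M_n => A (Ordinal ilt) (Ordinal jlt)) cd; rewrite !mxE /=.
apply: (dec_inj fld); [apply: wci | apply: wdi]; apply: mem_nth; by rewrite ?sci ?sdi.
Qed.

End Matrices.

End Decoding.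

(** * Enumeration of words in two generators *)

Section Words.

Variables (C : eqType) (mul : C -> C -> C) (one s t : C).

(* Breadth-first enumeration of the monoid generated by [s] and [t]: the entry
   [(i, b)] of [par] adds the product of the [i]-th element found so far with a generator. *)
Definition enum_words (par : seq (nat * bool)) : seq C :=
  foldl (fun L ib => rcons L (mul (nth one L ib.1) (if ib.2 then t else s))) [:: one] par.

Definition closed_words (L : seq C) : bool :=
  all (fun x => (mul x s \in L) && (mul x t \in L)) L.

Lemma enum_words_ind (P : C -> Prop) par : P one ->
  (forall x, P x -> P (mul x s)) -> (forall x, P x -> P (mul x t)) ->
  {in enum_words par, forall x, P x}.
Proof.
move=> P1 Ps Pt; rewrite /enum_words.
have : {in [:: one], forall x, P x} by move=> x; rewrite inE => /eqP->.
elim: par [:: one] => [|[i b] par IHp] L PL //=; apply: IHp => x.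
rewrite mem_rcons inE => /orP[/eqP->|/PL//].
have Pi : P (nth one L i).
  (* An index out of range yields the default [one], which satisfies [P] too. *)
  by case: (ltnP i (size L)) => iL; [apply/PL/mem_nth | rewrite nth_default].
by case: b; [apply: Pt | apply: Ps].
Qed.

(** Stability under the generators extends to all products by induction on the second factor as a
    word. Associativity is assumed of [op] and not of [mul], whence the statement on decoded
    elements. *)
Lemma enum_words_mul (T : eqType) (op : T -> T -> T) (d : C -> T) par :
  associative op -> (forall x y, d (mul x y) = op (d x) (d y)) ->
  (forall x, op x (d one) = x) -> closed_words (enum_words par) ->
  {in map d (enum_words par) &, forall x y, op x y \in map d (enum_words par)}.
Proof.
move=> opA dM d1 /allP cl x y xL /mapP[c cL ->]; move: c cL x xL.
apply: enum_words_ind => [x xL | c IHc x xL | c IHc x xL]; first by rewrite d1.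
  rewrite dM opA; have /mapP[e /cl/andP[eL _] ->] := IHc x xL.
  by rewrite -dM map_f.
rewrite dM opA; have /mapP[e /cl/andP[_ eL] ->] := IHc x xL.
by rewrite -dM map_f.
Qed.

End Words.

Lemma card_seq_preim (T U : finType) (f : T -> U) (D : {set T}) (s : seq U) :
  injective f -> uniq s -> (forall x, (x \in D) = (f x \in s)) ->
  {in s, forall y, exists x, f x = y} -> #|D| = size s.
Proof.
move=> finj us Ds sf; rewrite -(card_imset D finj) -(card_uniqP us).
apply: eq_card => y; apply/imsetP/idP => [[x xD ->]|ys]; first by rewrite -Ds.
by have [x fx] := sf y ys; exists x; rewrite // Ds fx.
Qed.

(** * Certificates for a subgroup of SL(2,q) and its core *)

Section Check.

Variables p al be q : nat.
Local Open Scope nat_scope.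
Local Notation mul := (code_mx_mul p al be 2).

Definition code_scalar (c : code) : bool :=
  [&& code_ent c 0 1 == 0, code_ent c 1 0 == 0 & code_ent c 0 0 == code_ent c 1 1].

Definition code_det1 (c : code) : bool :=
  code_mul p al be (code_ent c 0 0) (code_ent c 1 1)
    == code_add p 1 (code_mul p al be (code_ent c 0 1) (code_ent c 1 0)).

(** Well-formedness of [e] lets [e \notin L] survive decoding, which is injective on well-formed
    codes. *)
Definition code_moved (L : seq code) (c : code) (g : code * code) : bool :=
  let e := mul (mul g.1 c) g.2 in code_wf 2 q e && (e \notin L).

Definition code_subgroup (s t : code) (L : seq code) : bool :=
  [&& closed_words mul s t L, all (code_wf 2 q) L, uniq L, all code_det1 L &
      code1 2 \in L].

(* The pairs in [gs] are of the form (g^-1, g): conjugation by the elements g moves every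
   non-scalar element of the subgroup out of it, so its core is the centre. *)
Definition code_core (gs : seq (code * code)) (L : seq code) : bool :=
  [&& [:: [:: p.-1; 0]; [:: 0; p.-1]] \in L,
      all (fun g => (mul g.1 g.2 == code1 2) && code_det1 g.2) gs &
      all (fun c => code_scalar c || has (code_moved L c) gs) L].

End Check.

(** * From a certificate to an alternating group *)

Section CodedSubgroup.

Variables (F : finFieldType) (p al be q : nat) (w : F).
Hypothesis chF : p \in [pchar F].
Hypothesis wE : w ^+ 2 = al%:R * w + be%:R.
Hypothesis fld : code_field p al be q.

Local Notation dm := (@decmx F p w 2).
Local Notation mul := (code_mx_mul p al be 2).

Lemma decmx_det1 c : code_det1 p al be c -> \det (dm c) = 1.
Proof.
move=> /eqP/(congr1 (dec p w)); rewrite mx2_detE !mxE.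
by rewrite (decD _ chF) !(decM chF wE) (dec1 _ chF) => ->; rewrite addrK.
Qed.

Lemma decmx_SL2 c : code_det1 p al be c -> exists2 x, x \in SL 1 F & GLval x = dm c.
Proof.
move=> /decmx_det1 d; have uA : dm c \is a GRing.unit.
  by rewrite -[_ \is a _]/(dm c \in unitmx) unitmxE d unitr1.
by exists (Sub (dm c) uA : {'GL_2[F]}); rewrite ?inE ?SubK ?d.
Qed.

(** In a finite group a subset containing 1 and closed under products is a subgroup, so no inverses
    have to be checked. *)
Lemma coded_subgroup s t par (L := enum_words mul (code1 2) s t par) :
  code_subgroup p al be q s t L ->
  exists H : {group {'GL_2[F]}},
    [/\ H \subset SL 1 F, #|H| = size L & forall x, (x \in H) = (GLval x \in map dm L)].
Proof.
case/and5P=> cl /allP wf uL /allP det1 oneL.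
have LM := enum_words_mul (@mulmxA _ 2 2 2 2) (decmxM chF wE 2)
  (fun A => etrans (congr1 (mulmx A) (decmx1 w chF 2)) (mulmx1 A)) cl.
have gH : group_set [set x : {'GL_2[F]} | GLval x \in map dm L].
  apply/group_setP; split=> [|x y]; rewrite !inE.
    by rewrite GL_1E -[1]/(1%:M) -(decmx1 w chF) map_f.
  by rewrite GL_MxE; apply: LM.
exists (Group gH); split=> [||x]; last by rewrite inE.
- apply/subsetP=> x; rewrite !inE => /mapP[c cL ->].
  by rewrite decmx_det1 ?det1.
- rewrite -(size_map dm); apply: (@card_seq_preim _ _ (@GLval 2 F)) => [|||A].
  + exact: val_inj.
  + by rewrite map_inj_in_uniq // => c d cL dL; apply: (decmx_inj chF wE fld); apply: wf.
  + by move=> x; rewrite inE.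
  + by case/mapP=> c /det1/decmx_SL2[x _ xE] ->; exists x.
Qed.

Lemma coded_isog_Alt s t par gs m (L := enum_words mul (code1 2) s t par) :
  code_subgroup p al be q s t L -> code_core p al be q gs L ->
  (4 < m)%N -> (size L * m = #|SL 1 F|)%N -> (2 * #|SL 1 F| = m`! * #|'Z(SL 1 F)|)%N ->
  L_ 2 F \isog 'Alt_('I_m).
Proof.
move=> sub /and3P[mL /allP gsP /allP core] m5 szL oSL.
have [H [sH oH memH]] := coded_subgroup sub.
have /and5P[_ /allP wf _ _ oneL] := sub.
have idx : #|SL 1 F : H| = m.
  by rewrite -divgS // -szL oH mulKn // -oH cardG_gt0.
have coreZ : gcore H (SL 1 F) = 'Z(SL 1 F).
  apply/eqP; rewrite eqEsubset; apply/andP; split; last first.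
    apply: gcore_max; last by apply: gFnorm.
    (* A central element is a scalar of square 1, hence 1 or -1, and both are listed. *)
    apply/subsetP=> x /SL2_centerP[/SL2P xS x12 x21 x1122].
    have : ent11 x ^+ 2 = 1 by rewrite -xS x12 -x1122; ring.
    move/eqP; rewrite sqrf_eq1 memH => /orP[]/eqP x11.
      suff -> : GLval x = dm (code1 2) by rewrite map_f.
      rewrite decmx1 //; apply/matrixP=> i j; rewrite mxE.
      by case: (ord2_case i) => ->; case: (ord2_case j) => ->; rewrite // -/(ent22 x) -x1122.
    suff -> : GLval x = dm [:: [:: p.-1; 0]; [:: 0; p.-1]] by rewrite map_f.
    apply/matrixP=> i j; rewrite mxE.
    by case: (ord2_case i) => ->; case: (ord2_case j) => ->;
      rewrite /code_ent /= ?dec0 ?(decN1 _ chF) // -/(ent22 x) -x1122.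
  apply/subsetP=> x xC; have xH := subsetP (gcore_sub _ _) x xC.
  have xS := subsetP sH x xH.
  move: (xH); rewrite memH => /mapP[c cL xE].
  case/orP: (core c cL) => [/and3P[/eqP c01 /eqP c10 /eqP c00]|/hasP[g gL /andP[ewf /negP[]]]].
    apply/SL2_centerP; split=> //; rewrite /ent12 /ent21 /ent11 /ent22 xE !mxE.
    - by rewrite c01 dec0.
    - by rewrite c10 dec0.
    - by rewrite c00.
  have /andP[/eqP gg1 /decmx_SL2[y yS yE]] := gsP g gL.
  have yV : GLval y^-1%g = dm g.1.
    have e : dm g.1 *m GLval y = 1%:M by rewrite yE -(decmxM chF wE) gg1 decmx1.
    rewrite GL_VxE -[RHS](mulmxK (GL_unitmx y)) e mul1mx //.
  (* The core is stable under conjugation, while [y] was certified to move [x] out of [H]. *)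
  have : (x ^ y)%g \in H.
    apply: (subsetP (gcore_sub H (SL 1 F))); rewrite memJ_norm //.
    by apply: subsetP yS; apply: gcore_norm.
  rewrite memH conjgE !GL_MxE yV xE yE mulmxA -!(decmxM chF wE) => /mapP[d dL].
  by move/(decmx_inj chF wE fld)=> -> //; apply: wf.
rewrite /L_ /PSL /= -coreZ; apply: isog_coset_Alt => //.
by rewrite /= coreZ.
Qed.

End CodedSubgroup.

(** * Subgroups of index 5, 5 and 6 in L_2(4), L_2(5) and L_2(9) *)

Definition parents4 : seq (nat * bool) :=
  [::
   (0, false); (0, true); (1, true); (2, false); (2, true); (3, false); (3, true); (4,
   true); (5, false); (8, true); (9, true)].

Definition parents5 : seq (nat * bool) :=
  [::
   (0, false); (0, true); (1, false); (1, true); (2, false); (2, true); (3, false); (3,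
   true); (4, false); (4, true); (5, true); (6, false); (7, true); (8, false); (8, true);
   (10, false); (11, true); (12, true); (13, false); (13, true); (15, false); (16, true);
   (17, false)].

Definition parents9 : seq (nat * bool) :=
  [::
   (0, false); (0, true); (1, false); (1, true); (2, false); (2, true); (3, false); (3,
   true); (4, false); (4, true); (5, true); (6, false); (6, true); (7, true); (8, false);
   (8, true); (9, true); (10, false); (10, true); (11, false); (11, true); (12, true);
   (13, false); (13, true); (14, false); (14, true); (15, true); (16, false); (16, true);
   (17, false); (17, true); (18, true); (19, false); (21, false); (21, true); (22, false);
   (22, true); (23, true); (25, true); (26, false); (26, true); (27, false); (27, true);
   (28, true); (29, false); (31, false); (31, true); (32, false); (32, true); (33, true);
   (34, true); (35, false); (37, false); (37, true); (38, false); (38, true); (39, true);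
   (40, true); (43, false); (43, true); (44, false); (44, true); (45, true); (47, false);
   (49, false); (49, true); (50, false); (50, true); (51, true); (52, true); (53, true);
   (54, false); (56, false); (56, true); (57, false); (57, true); (58, false); (58, true);
   (62, false); (62, true); (63, false); (63, true); (64, true); (65, true); (66, false);
   (68, false); (68, true); (69, false); (69, true); (70, false); (70, true); (71, true);
   (72, true); (73, true); (74, false); (78, false); (78, true); (82, false); (82, true);
   (83, true); (85, true); (86, true); (89, false); (91, false); (91, true); (92, true);
   (93, false); (93, true); (94, true); (95, true); (100, false); (100, true); (101,
   false); (101, true); (102, true); (106, false); (108, false); (109, true); (110, false)].

Definition code2 (a b c d : nat) : code := [:: [:: a; b]; [:: c; d]].

(** A transvection and the diagonal matrix of [w] and its inverse generate the upper triangular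
    matrices, of order 12 and index 5. *)
Lemma isog_L2_4_Alt5 (F : finFieldType) : #|F| = 4%N -> L_ 2 F \isog 'Alt_('I_5).
Proof.
move=> oF; have oF2 : #|F| = (2 ^ 2)%N by rewrite oF.
have chF := card_finPcharP oF2 (isT : prime 2).
have [w wE] : exists w : F, w ^+ 2 = 1%:R * w + 1%:R.
  (* Any [w] other than 0 and 1 will do: dividing w^4 - w by w(w - 1) leaves w^2 + w + 1 = 0. *)
  have /subsetPn[w _] : ~~ ([set: F] \subset [set 0; 1]).
    apply: contraL (isT : 2 < 4)%N => /subset_leq_card; rewrite cardsT oF => le4.
    by rewrite -leqNgt; apply: leq_trans le4 _; rewrite cards2; case: (_ != _).
  rewrite !inE negb_or => /andP[w0 w1]; exists w; rewrite mul1r.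
  have w4 := expf_card w; rewrite oF in w4; rewrite -subr_eq0 in w1.
  have two0 : 2%:R = 0 :> F by apply: pcharf0.
  apply: (mulfI w0); apply: (mulfI w1).
  by apply: (lincomb2 (k := 1) (k' := w - w ^+ 3) w4 two0); ring.
apply: (@coded_isog_Alt F 2 1 1 4 w chF wE _ (code2 1 1 0 1) (code2 2 0 0 3) parents4
          [:: (code2 0 1 1 0, code2 0 1 1 0); (code2 1 0 1 1, code2 1 0 1 1)]).
- by vm_compute.
- by vm_compute.
- by vm_compute.
- by [].
- by rewrite card_SL2 oF; vm_compute.
- by rewrite card_SL2 (card_Z (isT : prime 2) (isT : 0 < 2)%N oF2) oF; vm_compute.
Qed.

(** The two generators span a copy of SL(2,3), of order 24, whose image has index 5. *)
Lemma isog_L2_5_Alt5 (F : finFieldType) : #|F| = 5%N -> L_ 2 F \isog 'Alt_('I_5).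
Proof.
move=> oF; have oF1 : #|F| = (5 ^ 1)%N by rewrite oF.
have chF := card_finPcharP oF1 (isT : prime 5).
have wE : (0 : F) ^+ 2 = 0%:R * 0 + 0%:R by ring.
apply: (@coded_isog_Alt F 5 0 0 5 0 chF wE _ (code2 0 1 4 0) (code2 1 1 2 3) parents5
          [:: (code2 1 4 0 1, code2 1 1 0 1); (code2 1 0 4 1, code2 1 0 1 1)]).
- by vm_compute.
- by vm_compute.
- by vm_compute.
- by [].
- by rewrite card_SL2 oF; vm_compute.
- by rewrite card_SL2 (card_Z (isT : prime 5) (isT : 0 < 1)%N oF1) oF; vm_compute.
Qed.

(* The two generators span a copy of SL(2,5), whose image has index 6 in L_2(9). *)
Lemma isog_L2_9_Alt6 (F : finFieldType) : #|F| = 9%N -> L_ 2 F \isog 'Alt_('I_6).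
Proof.
move=> oF; have oF2 : #|F| = (3 ^ 2)%N by rewrite oF.
have chF := card_finPcharP oF2 (isT : prime 3).
have three0 : 3%:R = 0 :> F by apply: pcharf0.
have [w wE] : exists w : F, w ^+ 2 = 0%:R * w + 2%:R.
  (* At most 4 of the 8 units satisfy u^4 = 1; for any other, u^8 = 1 gives u^4 = -1, so u^2 is a
     square root of -1 = 2. *)
  have [u u0 u4] : exists2 u : F, u != 0 & u ^+ 4 != 1.
    apply/exists_inP; apply: contraT; rewrite negb_exists_in => /forall_inP all1.
    have le4 : (size (enum [set~ (0%R : F)]) <= 4)%N.
      apply: max_unity_roots; rewrite ?enum_uniq //; apply/allP=> u.
      by rewrite mem_enum !inE => /all1; rewrite negbK unity_rootE.
    by move: le4; rewrite -cardE cardsC1 oF.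
  exists (u ^+ 2); rewrite mul0r add0r -exprM.
  have : (u ^+ 4) ^+ 2 == 1.
    have u9 := expf_card u; rewrite oF in u9.
    by apply/eqP; apply: (mulfI u0); rewrite mulr1 -exprM -exprS.
  rewrite sqrf_eq1 (negPf u4) /= => /eqP ->.
  by apply: (lincomb1 (k := -1) three0); ring.
apply: (@coded_isog_Alt F 3 0 2 9 w chF wE _ (code2 0 1 2 0) (code2 0 1 2 4) parents9
          [:: (code2 1 2 0 1, code2 1 1 0 1); (code2 1 6 0 1, code2 1 3 0 1);
              (code2 1 0 2 1, code2 1 0 1 1)]).
- by vm_compute.
- by vm_compute.
- by vm_compute.
- by [].
- by rewrite card_SL2 oF; vm_compute.
- by rewrite card_SL2 (card_Z (isT : prime 3) (isT : 0 < 2)%N oF2) oF; vm_compute.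
Qed.

(** * The graph of the map from SL(2,7) to SL(3,2) *)

Section PairCodes.

Local Open Scope nat_scope.

Definition pair_mul (c d : code * code) : code * code :=
  (code_mx_mul 7 0 0 2 c.1 d.1, code_mx_mul 2 0 0 3 c.2 d.2).

Definition pair_one : code * code := (code1 2, code1 3).

Definition gen3_s : code := [:: [:: 0; 0; 1]; [:: 0; 1; 0]; [:: 1; 0; 0]].
Definition gen3_t : code := [:: [:: 0; 0; 1]; [:: 1; 0; 0]; [:: 1; 1; 0]].
(** Inverses of the two generators over the field of order 2, certifying that these are
    invertible. *)
Definition gen3_s' : code := gen3_s.
Definition gen3_t' : code := [:: [:: 0; 1; 0]; [:: 0; 1; 1]; [:: 1; 0; 0]].

(** Generators of SL(2,7) of orders 4 and 7, paired with their images; the square of the first is -1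
    and goes to 1. *)
Definition pair_s : code * code := (code2 0 1 6 0, gen3_s).
Definition pair_t : code * code := (code2 1 1 0 1, gen3_t).

Definition parents7 : seq (nat * bool) :=
  [::
   (0, false); (0, true); (1, false); (1, true); (2, false); (2, true); (3, false); (3,
   true); (4, false); (4, true); (5, true); (6, false); (6, true); (7, true); (8, false);
   (8, true); (9, true); (10, false); (10, true); (11, false); (11, true); (12, true);
   (13, false); (13, true); (14, false); (14, true); (15, true); (16, false); (16, true);
   (17, false); (17, true); (18, true); (19, false); (19, true); (21, false); (21, true);
   (22, false); (22, true); (23, true); (24, false); (24, true); (25, true); (26, false);
   (26, true); (27, false); (27, true); (28, true); (29, false); (29, true); (31, false);
   (31, true); (32, false); (32, true); (33, true); (34, false); (34, true); (35, true);
   (36, false); (36, true); (38, false); (38, true); (39, false); (39, true); (40, true);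
   (41, false); (42, false); (42, true); (43, true); (44, false); (44, true); (46, false);
   (46, true); (47, false); (47, true); (48, true); (49, false); (49, true); (51, false);
   (51, true); (53, false); (53, true); (54, false); (54, true); (55, true); (56, false);
   (57, true); (58, true); (59, false); (59, true); (60, true); (61, false); (61, true);
   (63, false); (63, true); (64, false); (64, true); (65, true); (67, false); (67, true);
   (68, false); (68, true); (69, true); (70, false); (70, true); (72, false); (72, true);
   (74, false); (74, true); (75, false); (75, true); (76, true); (77, false); (78, true);
   (79, false); (79, true); (80, true); (81, false); (81, true); (83, false); (83, true);
   (84, false); (84, true); (85, true); (86, false); (86, true); (87, false); (87, true);
   (88, true); (89, false); (90, true); (91, true); (92, false); (92, true); (93, true);
   (94, false); (94, true); (96, false); (96, true); (97, false); (97, true); (99, false);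
   (99, true); (101, false); (101, true); (102, false); (102, true); (103, true); (105,
   true); (106, false); (106, true); (108, false); (108, true); (110, false); (110, true);
   (111, false); (111, true); (112, true); (113, false); (113, true); (114, true); (115,
   false); (116, true); (117, true); (118, false); (118, true); (119, true); (120, false);
   (120, true); (122, false); (122, true); (123, false); (123, true); (125, false); (125,
   true); (127, false); (127, true); (128, false); (128, true); (129, true); (130, false);
   (130, true); (131, false); (132, true); (133, false); (134, true); (135, true); (136,
   false); (136, true); (137, true); (138, false); (140, false); (140, true); (141, true);
   (142, false); (142, true); (144, false); (144, true); (146, false); (146, true); (147,
   false); (147, true); (148, false); (148, true); (149, true); (151, true); (152, false);
   (152, true); (154, false); (154, true); (156, false); (156, true); (157, false); (157,
   true); (159, true); (160, false); (160, true); (161, true); (162, false); (162, true);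
   (164, true); (165, false); (166, true); (167, true); (168, false); (168, true); (169,
   true); (170, false); (172, false); (172, true); (173, true); (174, false); (174, true);
   (175, true); (176, false); (176, true); (178, false); (178, true); (179, false); (179,
   true); (181, false); (181, true); (183, false); (183, true); (184, true); (185, false);
   (185, true); (186, false); (187, true); (188, false); (189, true); (190, true); (191,
   true); (192, false); (193, false); (194, true); (197, false); (197, true); (199,
   false); (199, true); (201, false); (201, true); (203, true); (204, false); (204, true);
   (206, true); (208, true); (209, false); (209, true); (211, false); (213, false); (213,
   true); (214, false); (214, true); (216, false); (217, false); (217, true); (219,
   false); (220, false); (220, true); (221, true); (222, false); (222, true); (223,
   false); (225, false); (227, true); (229, false); (231, true); (233, true); (235,
   false); (235, true); (236, true); (239, false); (240, true); (243, false); (243, true);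
   (244, false); (244, true); (246, true); (248, true); (250, true); (251, false); (253,
   true); (255, false); (255, true); (256, true); (258, true); (259, true); (262, false);
   (262, true); (264, false); (265, false); (265, true); (269, true); (271, false); (273,
   false); (273, true); (274, true); (276, false); (277, true); (279, false); (279, true);
   (280, false); (280, true); (282, true); (285, false); (286, true); (287, false); (288,
   true); (290, false); (300, true); (302, false); (305, true); (309, true); (312, false);
   (314, true)].

Definition not_commute3 (c g : code) : bool :=
  let: (u, v) := (code_mx_mul 2 0 0 3 c g, code_mx_mul 2 0 0 3 g c) in
  [&& code_wf 3 2 u, code_wf 3 2 v & u != v].

(** Distinct first components make the list the graph of a function, and 336 = |SL(2,7)| makes that
    function total. The last two conditions bound its kernel and show that the centre of SL(3,2) is
    trivial. *)
Definition graph_check (L : seq (code * code)) : bool :=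
  [&& closed_words pair_mul pair_s pair_t L,
      all (fun c => code_wf 2 7 c.1 && code_wf 3 2 c.2) L,
      uniq (map fst L),
      all (fun c => code_det1 7 0 0 c.1) L,
      size L == 336,
      all (fun c => (c.2 == code1 3) ==> (c.1 \in [:: code1 2; code2 6 0 0 6])) L &
      all (fun c => [|| c.2 == code1 3, not_commute3 c.2 gen3_s
                      | not_commute3 c.2 gen3_t]) L].

End PairCodes.

Lemma uniq_map_inj (T U : eqType) (f : T -> U) (s : seq T) :
  uniq (map f s) -> {in s &, injective f}.
Proof.
elim: s => //= x s IHs /andP[xs us] y z; rewrite !inE.
case/orP=> [/eqP->|ys]; case/orP=> [/eqP->|zs] // fyz.
- by rewrite fyz map_f in xs.
- by rewrite -fyz map_f in xs.
- exact: IHs fyz.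
Qed.

Lemma code_field2 : code_field 2 0 0 2.
Proof. by vm_compute. Qed.

Lemma code_field7 : code_field 7 0 0 7.
Proof. by vm_compute. Qed.

(** * The isomorphism of L_3(2) with L_2(7) *)

Section L3_2.

Variables F2 F7 : finFieldType.
Hypotheses (oF2 : #|F2| = 2%N) (oF7 : #|F7| = 7%N).

Variable par : seq (nat * bool).
Local Notation graph7 := (enum_words pair_mul pair_one pair_s pair_t par).
Hypothesis graph_ok : graph_check graph7.

Local Notation d2 := (@decmx F7 7 0 2).
Local Notation d3 := (@decmx F2 2 0 3).

Let chF2 : 2%N \in [pchar F2].
Proof. by apply: (@card_finPcharP _ _ 1); rewrite ?oF2. Qed.

Let chF7 : 7%N \in [pchar F7].
Proof. by apply: (@card_finPcharP _ _ 1); rewrite ?oF7. Qed.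

Let w2 : (0 : F2) ^+ 2 = 0%:R * 0 + 0%:R. Proof. by ring. Qed.
Let w7 : (0 : F7) ^+ 2 = 0%:R * 0 + 0%:R. Proof. by ring. Qed.

Let graph7_closed : closed_words pair_mul pair_s pair_t graph7.
Proof. by case/and5P: graph_ok. Qed.
Let graph7_wf : all (fun c => code_wf 2 7 c.1 && code_wf 3 2 c.2) graph7.
Proof. by case/and5P: graph_ok. Qed.
Let graph7_uniq : uniq (map fst graph7).
Proof. by case/and5P: graph_ok. Qed.
Let graph7_det1 : all (fun c => code_det1 7 0 0 c.1) graph7.
Proof. by case/and5P: graph_ok. Qed.
Let graph7_size : size graph7 = 336%N.
Proof. by case/and5P: graph_ok => _ _ _ _ /and3P[/eqP]. Qed.
Let graph7_kernel :
  all (fun c => (c.2 == code1 3) ==> (c.1 \in [:: code1 2; code2 6 0 0 6])) graph7.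
Proof. by case/and5P: graph_ok => _ _ _ _ /and3P[]. Qed.
Let graph7_center : all (fun c => [|| c.2 == code1 3, not_commute3 c.2 gen3_s
                                     | not_commute3 c.2 gen3_t]) graph7.
Proof. by case/and5P: graph_ok => _ _ _ _ /and3P[]. Qed.

Let dp (c : code * code) := (d2 c.1, d3 c.2).
Let op (A B : 'M[F7]_2 * 'M[F2]_3) := (A.1 *m B.1, A.2 *m B.2).

Definition graph_rel (x : {'GL_2[F7]}) (y : {'GL_3[F2]}) : bool :=
  (GLval x, GLval y) \in map dp graph7.

Lemma graph_relM x x' y y' :
  graph_rel x y -> graph_rel x' y' -> graph_rel (x * x')%g (y * y')%g.
Proof.
rewrite /graph_rel !GL_MxE => xy xy'.
apply: (enum_words_mul (op := op) _ _ _ graph7_closed xy xy').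
- by move=> [A1 A2] [B1 B2] [D1 D2]; rewrite /op /= !mulmxA.
- by move=> c e; rewrite /dp /= (decmxM chF7 w7) (decmxM chF2 w2).
- by move=> [A1 A2]; rewrite /op /= (decmx1 0 chF7) (decmx1 0 chF2) !mulmx1.
Qed.

Let wf2 c : c \in graph7 -> code_wf 2 7 c.1.
Proof. by move=> /(allP graph7_wf)/andP[]. Qed.
Let wf3 c : c \in graph7 -> code_wf 3 2 c.2.
Proof. by move=> /(allP graph7_wf)/andP[]. Qed.

Lemma graph_rel_uniq x y y' : graph_rel x y -> graph_rel x y' -> y = y'.
Proof.
move=> /mapP[c cL [xc yc]] /mapP[c' c'L [xc' yc']]; apply: val_inj.
have c1 : c.1 = c'.1 := decmx_inj chF7 w7 code_field7 (wf2 cL) (wf2 c'L) (etrans (esym xc) xc').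
have cc : c = c' := uniq_map_inj graph7_uniq cL c'L c1.
by rewrite cc in yc; apply: etrans yc (esym yc').
Qed.

Lemma gen3_unit g g' : code_mx_mul 2 0 0 3 g g' = code1 3 -> d3 g \in unitmx.
Proof.
move=> gg'; apply: (proj1 (mulmx1_unit (_ : d3 g *m d3 g' = 1%:M))).
by rewrite -(decmxM chF2 w2) gg' (decmx1 0 chF2).
Qed.

Lemma graph_unit3 c : c \in graph7 -> d3 c.2 \in unitmx.
Proof.
have us : d3 gen3_s \in unitmx by apply: (@gen3_unit _ gen3_s'); vm_compute.
have ut : d3 gen3_t \in unitmx by apply: (@gen3_unit _ gen3_t'); vm_compute.
move: c; apply: (@enum_words_ind _ _ _ _ _ (fun c => d3 c.2 \in unitmx)) => [|e ue|e ue].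
- by rewrite (decmx1 0 chF2) unitmx1.
- by rewrite /= (decmxM chF2 w2) unitmx_mul ue.
- by rewrite /= (decmxM chF2 w2) unitmx_mul ue.
Qed.

Lemma GL3_of_unit (A : 'M[F2]_3) : A \in unitmx -> exists y : {'GL_3[F2]}, GLval y = A.
Proof. by move=> uA; exists (Sub A (uA : A \is a GRing.unit)); apply: SubK. Qed.

(** The first components decode to 336 distinct elements of SL(2,7), which is its order. *)
Lemma graph_rel_total x : x \in SL 1 F7 -> exists y, graph_rel x y.
Proof.
pose D := [set x : {'GL_2[F7]} | GLval x \in map d2 (map fst graph7)].
have det1 c : c \in graph7 -> code_det1 7 0 0 c.1 := allP graph7_det1 c.
have oD : #|D| = 336%N.
  rewrite -graph7_size -(size_map fst) -(size_map d2).
  apply: (@card_seq_preim _ _ (@GLval 2 F7)) => [|||A].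
  - exact: val_inj.
  - rewrite map_inj_in_uniq ?graph7_uniq // => _ _ /mapP[c cL ->] /mapP[e eL ->].
    by apply: (decmx_inj chF7 w7 code_field7); apply: wf2.
  - by move=> y; rewrite inE.
  - by case/mapP=> _ /mapP[c /det1/(decmx_SL2 chF7 w7)[y _ yE] ->] ->; exists y.
have sD : D \subset SL 1 F7.
  apply/subsetP=> y; rewrite !inE => /mapP[_ /mapP[c /det1 cd ->] ->].
  by rewrite (decmx_det1 chF7 w7).
have -> : SL 1 F7 = D :> {set _}.
  by apply/esym/eqP; rewrite eqEcard sD oD card_SL2 oF7.
rewrite inE => /mapP[_ /mapP[c cL ->] xc].
have [y yc] := GL3_of_unit (graph_unit3 cL).
by exists y; apply/mapP; exists c; rewrite // xc yc.
Qed.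

Definition graph_fun (x : {'GL_2[F7]}) : {'GL_3[F2]} := odflt 1%g [pick y | graph_rel x y].

Lemma graph_funP x : x \in SL 1 F7 -> graph_rel x (graph_fun x).
Proof.
case/graph_rel_total=> y xy; rewrite /graph_fun; case: pickP => // /(_ y).
by rewrite xy.
Qed.

Lemma graph_funM : {in SL 1 F7 &, {morph graph_fun : x y / (x * y)%g}}.
Proof.
move=> x y xS yS; apply: (@graph_rel_uniq (x * y)%g).
  by apply: graph_funP; rewrite groupM.
by apply: graph_relM; apply: graph_funP.
Qed.

Canonical graph_morphism := Morphism graph_funM.

Let oSL : #|SL 1 F7| = 336%N.
Proof. by rewrite card_SL2 oF7. Qed.

Let oZ : #|'Z(SL 1 F7)| = 2%N.
Proof. by rewrite (@card_Z _ 7 1) ?oF7. Qed.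

Let oGL : #|[set: {'GL_3[F2]}]| = 168%N.
Proof.
rewrite -[[set: _]]/('GL_3[F2]%g : {set _}) card_GL // oF2.
by rewrite unlock; vm_compute.
Qed.

(** The certificate puts the kernel inside the centre, of order 2; a trivial kernel would give an
    image of order 336 in a group of order 168. *)
Lemma ker_graph_morphism : 'ker graph_morphism = 'Z(SL 1 F7).
Proof.
have sKZ : 'ker graph_morphism \subset 'Z(SL 1 F7).
  apply/subsetP=> x /morphpreP[xS /set1P /= fx]; have := graph_funP xS.
  rewrite fx => /mapP[c cL [xc c1]].
  have c2 : c.2 = code1 3.
    apply: (decmx_inj chF2 w2 code_field2); [exact: wf3 | by vm_compute|].
    by rewrite -c1 (decmx1 0 chF2).
  have [a cE] : exists a, c.1 = code2 a 0 0 a.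
    have : (c.1 == code1 2) || (c.1 == code2 6 0 0 6).
      by have := allP graph7_kernel c cL; rewrite c2 eqxx /= !inE.
    by case/orP=> /eqP ->; [exists 1%N | exists 6%N].
  apply/SL2_centerP; split; rewrite // /ent12 /ent21 /ent11 /ent22 xc cE !mxE //.
  - by rewrite /code_ent /= dec0.
  - by rewrite /code_ent /= dec0.
apply/eqP; rewrite eqEcard sKZ oZ /=.
have : (#|graph_morphism @* SL 1 F7| <= 168)%N.
  by rewrite -oGL; apply: subset_leq_card (subsetT _).
rewrite card_morphim setIid -divgS ?subsetIl // oSL.
case: #|'ker graph_morphism| (cardG_gt0 ('ker graph_morphism)) => [|[|]] //.
Qed.

Lemma im_graph_morphism : graph_morphism @* SL 1 F7 = [set: {'GL_3[F2]}].
Proof.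
apply/eqP; rewrite eqEcard subsetT oGL card_morphim setIid.
by rewrite ker_graph_morphism -divgS ?center_sub // oSL oZ.
Qed.

Lemma SL3_F2 : SL 2 F2 = [set: {'GL_3[F2]}] :> {set _}.
Proof.
apply/setP=> y; rewrite !inE; have := GL_det y; rewrite /=.
have F01 : [set: F2] = [set 0; 1].
  apply/esym/eqP; rewrite eqEcard subsetT cardsT oF2 cards2 eq_sym oner_eq0 //.
have : \det (GLval y) \in [set 0; 1] by rewrite -F01 in_setT.
by rewrite !inE => /orP[/eqP->|/eqP->]; rewrite ?eqxx.
Qed.

(** The map is onto, so every element occurs as a second component, and each of these except 1 fails
    to commute with one of the generators. *)
Lemma center_SL3_F2 : 'Z(SL 2 F2) = 1%g.
Proof.
apply/trivgP/subsetP=> z /centerP[_ cz].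
have : z \in graph_morphism @* SL 1 F7 by rewrite im_graph_morphism inE.
case/morphimP=> x _ xS /= zx; have := graph_funP xS; rewrite -zx => /mapP[c cL [_ zc]].
have nc g g' : code_mx_mul 2 0 0 3 g g' = code1 3 -> ~~ not_commute3 c.2 g.
  move=> gg'; have [y yE] := GL3_of_unit (gen3_unit gg').
  have yS : y \in SL 2 F2 by rewrite SL3_F2 inE.
  have := congr1 (@GLval 3 F2) (cz y yS); rewrite !GL_MxE zc yE -!(decmxM chF2 w2) => e.
  apply/negP=> /and3P[wu wv /eqP[]]; exact: (decmx_inj chF2 w2 code_field2 wu wv e).
case/or3P: (allP graph7_center c cL) => [/eqP c2|ncs|nct].
- by rewrite inE; apply/eqP/val_inj; rewrite /= zc c2 (decmx1 0 chF2).
- by have := @nc gen3_s gen3_s'; rewrite ncs => /(_ (erefl _)).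
- by have := @nc gen3_t gen3_t'; rewrite nct => /(_ (erefl _)).
Qed.

Lemma isog_L3_2_graph : L_ 3 F2 \isog L_ 2 F7.
Proof.
rewrite isog_sym; have iso := first_isog graph_morphism.
rewrite im_graph_morphism ker_graph_morphism -SL3_F2 in iso.
apply: isog_trans iso _; rewrite /L_ /PSL /= center_SL3_F2.
exact: quotient1_isog.
Qed.

End L3_2.

Lemma isog_L3_2_L2_7 (F2 F7 : finFieldType) : #|F2| = 2%N -> #|F7| = 7%N ->
  L_ 3 F2 \isog L_ 2 F7.
Proof.
move=> oF2 oF7; apply: (isog_L3_2_graph oF2 oF7 (par := parents7)).
by vm_compute.
Qed.

Local Close Scope ring_scope.
Local Close Scope group_scope.

(** * The theorem and its numerical cases *)

Lemma kappa_Z_prime_power (p e : nat) : prime p -> kappa_Z (p ^ e) = (p ^ e) ^ (p ^ e - 2).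
Proof.
move=> pr_p; have pe0 : 0 < p ^ e by rewrite expn_gt0 prime_gt0.
rewrite /kappa_Z -[in RHS](card_Zp pe0).
apply: (@kappa_cyclic_pgroup _ p (Zp_group (p ^ e))).
  by rewrite /pgroup card_Zp // pnatX pnat_id.
by rewrite /= /Zp; case: ifP => _; rewrite ?cyclic1 // Zp_cycle cycle_cyclic.
Qed.

Theorem theorem5p1 :
  (forall (p n : nat) (F : finFieldType),
     prime p -> 0 < n -> #|F| = p ^ n ->
     (p, n) <> (2, 1) -> (p, n) <> (3, 1) ->
     let q := p ^ n in
     let k := gcdn q.-1 2 in
     kappa (L_ 2 F) =
       p ^ ((q ^ 2 - 1) * (p - 2) %/ (p - 1))
       * kappa_Z (q.-1 %/ k) ^ (q * q.+1 %/ 2)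
       * kappa_Z (q.+1 %/ k) ^ (q * q.-1 %/ 2))
  /\
  (forall F4 F5 : finFieldType, #|F4| = 4 -> #|F5| = 5 ->
     (('Alt_('I_5))%g \isog L_ 2 F5) /\ (L_ 2 F5 \isog L_ 2 F4) /\
     kappa (('Alt_('I_5))%g) = 3 ^ 10 * 5 ^ 18)
  /\
  (forall F2 F7 : finFieldType, #|F2| = 2 -> #|F7| = 7 ->
     (L_ 3 F2 \isog L_ 2 F7) /\
     kappa (L_ 3 F2) = 2 ^ 84 * 3 ^ 28 * 7 ^ 40)
  /\
  (forall F9 : finFieldType, #|F9| = 9 ->
     (('Alt_('I_6))%g \isog L_ 2 F9) /\
     kappa (('Alt_('I_6))%g) = 2 ^ 180 * 3 ^ 40 * 5 ^ 108).
Proof.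
(* The cyclic parts of L_2(4), L_2(7) and L_2(9) have orders 3 and 5, 3 and 4, 4 and 5: all prime
   powers, with complete power graphs. *)
have kZ p e m : prime p -> p ^ e = m -> kappa_Z m = m ^ (m - 2).
  by move=> pr_p <-; apply: kappa_Z_prime_power.
have kZ3 : kappa_Z 3 = 3 ^ 1 by rewrite (kZ 3 1 3 isT erefl).
have kZ4 : kappa_Z 4 = 2 ^ 4 by rewrite (kZ 2 2 4 isT erefl).
have kZ5 : kappa_Z 5 = 5 ^ 3 by rewrite (kZ 5 1 5 isT erefl).
split; last split; last split.
- move=> p n F pr_p n0 oF _ _ q k; rewrite /k /q -oF.
  exact: kappa_L2 pr_p n0 oF.
- move=> F4 F5 o4 o5; have iso4 := isog_L2_4_Alt5 o4; have iso5 := isog_L2_5_Alt5 o5.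
  split; first by rewrite isog_sym.
  split; first by apply: isog_trans iso5 _; rewrite isog_sym.
  have o22 : #|F4| = 2 ^ 2 by rewrite o4.
  (* The value for A_5 is read off from L_2(4), where the factor coming from the unipotent lines is
     2^0. *)
  rewrite -(kappa_isog iso4) (kappa_L2 (isT : prime 2) (isT : 0 < 2) o22) o4.
  rewrite (_ : 4.-1 %/ _ = 3); last by [].
  rewrite (_ : 4.+1 %/ _ = 5); last by [].
  rewrite (_ : _ %/ (2 - 1) = 0); last by [].
  rewrite expn0 mul1n kZ3 kZ5 -!expnM.
  by congr (_ ^ _ * _ ^ _).
- move=> F2 F7 o2 o7; have iso := isog_L3_2_L2_7 o2 o7; split=> //.
  have o71 : #|F7| = 7 ^ 1 by rewrite o7.
  rewrite (kappa_isog iso) (kappa_L2 (isT : prime 7) (isT : 0 < 1) o71) o7.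
  rewrite (_ : 7.-1 %/ _ = 3); last by [].
  rewrite (_ : 7.+1 %/ _ = 4); last by [].
  rewrite (_ : _ %/ (7 - 1) = 40); last by [].
  rewrite mulnC [X in _ * X]mulnC mulnA kZ3 kZ4 -!expnM.
  by congr (_ ^ _ * _ ^ _ * _ ^ _).
- move=> F9 o9; have iso := isog_L2_9_Alt6 o9; split; first by rewrite isog_sym.
  have o32 : #|F9| = 3 ^ 2 by rewrite o9.
  rewrite -(kappa_isog iso) (kappa_L2 (isT : prime 3) (isT : 0 < 2) o32) o9.
  rewrite (_ : 9.-1 %/ _ = 4); last by [].
  rewrite (_ : 9.+1 %/ _ = 5); last by [].
  rewrite (_ : _ %/ (3 - 1) = 40); last by [].
  rewrite [X in X * _]mulnC kZ4 kZ5 -!expnM.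
  by congr (_ ^ _ * _ ^ _ * _ ^ _).
Qed.
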